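(* Let $\Pi\colon M\to N$ be a surjective map of constant rank between smooth manifolds, $1\le p<n=\dim N<m=\dim M$, and suppose that the action of a Lie group $G$ on $M$ is $\Pi$-projectable. Let $\omega^1,\dots,\omega^p$ be a $[G]$-contact-invariant horizontal coframe on $J^\infty(N,p)$, and let $\mathcal{D}_1,\dots,\mathcal{D}_p$ be the dual invariant differential operators. For $i=1,\dots,p$, let $\widehat\omega^i$ be the horizontal component of the pull-back of $\omega^i$ under the prolongation of $\Pi$. Then, provided the non-singularity condition $\det D_0\Pi\neq0$ holds, $\widehat\omega^1,\dots,\widehat\omega^p$ form a $G$-contact-invariant horizontal coframe on an open subset of $J^\infty(M,p)$. Let $\widehat{\mathcal{D}}_1,\dots,\widehat{\mathcal{D}}_p$ be the dual invariant differential operators, defined by $d_H\widehat F=\sum_{j=1}^p(\widehat{\mathcal{D}}_j\widehat F)\,\widehat\omega^j$ for every differential function $\widehat F$ on $J^\infty(M,p)$. If $F\colon J^k(N,p)\to\mathbb{R}$ is any differential function on $N$ and $\widehat F=F\circ\Pi^{(k)}$ is the corresponding differential function on $M$, then $$\widehat{\mathcal{D}}_i\widehat F=\widehat{\mathcal{D}}_i(F\circ\Pi^{(k)})=(\mathcal{D}_iF)\circ\Pi^{(k+1)}=\widehat{\mathcal{D}_iF},\qquad i=1,\dots,p.$$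
   Context: All objects are smooth ($C^\infty$). Projectable action: for all $v\in N$, $g\in G$ there is $\bar v\in N$ with $g\cdot\Pi^{-1}\{v\}=\Pi^{-1}\{\bar v\}$; then $g\cdot v:=\bar v$ defines an action of $G$ on $N$, and $[G]=G/G_N^*$ with $G_N^*=\{g: g\cdot v=v\ \forall v\in N\}$. Jets: $J^k(M,p)$ ($0\le k\le\infty$) is the bundle of $k$-jets $\mathrm{j}_kS|_z$ of $p$-dimensional submanifolds of $M$; $J^k_\Pi(M,p)$ is the open subset of jets of submanifolds $S$ that are $\Pi$-regular, i.e. $T_zS\cap\ker d\Pi|_z=\{0\}$; $\Pi^{(k)}\colon J^k_\Pi(M,p)\to J^k(N,p)$, $\Pi^{(k)}(\mathrm{j}_kS|_z)=\mathrm{j}_k\Pi(S)|_{\Pi(z)}$. Group actions are prolonged by $g^{(k)}\cdot \mathrm{j}_kS|_z=\mathrm{j}_k(g\cdot S)|_{g\cdot z}$. A differential function is a smooth real function on an open subset of some $J^k$; the notation $F\colon J^k\to\mathbb{R}$ allows partial domains. Forms: local coordinates $(x,u)=(x^1,\dots,x^p,u^1,\dots,u^{m-p})$ on $M$ are fixed with the $x$'s as independent variables; among the local coordinates $v^1,\dots,v^n$ on $N$ the first $p$, denoted $y^1,\dots,y^p$ (so $y^k=\Pi^k(x,u)$), are the independent variables. One-forms on $J^\infty(M,p)$ split into horizontal forms, spanned by $dx^1,\dots,dx^p$, and contact forms, i.e. forms annihilated on restriction to the prolongation of any $p$-dimensional submanifold; $\pi_H$ denotes projection to the horizontal component, $d=d_H+d_V$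 the corresponding splitting of the differential, so $d_HF=\pi_H(dF)$. Likewise on $J^\infty(N,p)$ with horizontal forms spanned by $dy^1,\dots,dy^p$. A $[G]$-contact-invariant horizontal coframe on $J^\infty(N,p)$ is a linearly independent set of $p$ horizontal one-forms $\omega^i=\sum_jQ^i_j\,dy^j$, with coefficients differential functions of some finite order, such that for each $[g]\in[G]$ the pull-back of $\omega^i$ under the prolonged transformation agrees with $\omega^i$ modulo contact forms; $G$-contact-invariant horizontal coframes on $J^\infty(M,p)$ are defined in the same way. The dual operators $\mathcal{D}_j$ are defined by $d_HF=\sum_j(\mathcal{D}_jF)\,\omega^j$ for all differential functions $F$ on $J^\infty(N,p)$. For a differential function $F$ on $J^k(N,p)$, $\widehat F:=F\circ\Pi^{(k)}$. $D_0\Pi=(D_i\Pi^k)_{i,k=1,\dots,p}$ is the $p\times p$ matrix of total derivatives $D_i\Pi^k=\frac{\partial\Pi^k}{\partial x^i}+\sum_{\alpha=1}^{m-p}\frac{\partial u^\alpha}{\partial x^i}\frac{\partial\Pi^k}{\partial u^\alpha}$, the first $p$ columns of the total derivative matrix of $\Pi$. *)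

(* Defs.v *)
From HB Require Import structures.
From mathcomp Require Import all_boot all_order all_algebra.
From mathcomp Require Import all_classical all_reals all_analysis.
Import Order.TTheory GRing.Theory Num.Theory numFieldNormedType.Exports.

Set Implicit Arguments.
Unset Strict Implicit.
Unset Printing Implicit Defensive.

Local Open Scope classical_set_scope.
Local Open Scope ring_scope.

(* Only used on open sets [U]. *)
Fixpoint Ck (R : realType) (V W : normedModType R) (k : nat) (U : set V)
    (f : V -> W) : Prop :=
  match k with
  | 0 => forall x, U x -> {for x, continuous f}
  | k'.+1 => (forall x, U x -> differentiable f x) /\
             (forall v, Ck k' U (fun x => 'D_v f x))
  end.

Definition smooth_on (R : realType) (V W : normedModType R) (U : set V)
    (f : V -> W) : Prop := forall k, Ck k U f.

Definition smooth_near (R : realType) (V W : normedModType R) (x : V)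
    (f : V -> W) : Prop := exists U, [/\ open U, U x & smooth_on U f].

Record chart (R : realType) (d : nat) (T : topologicalType) := Chart {
  cdom : set T;
  cmap : T -> 'rV[R]_d;
  cinv : 'rV[R]_d -> T;
  cdom_open : open cdom;
  cimg_open : open (cmap @` cdom);
  cmapK : forall a, cdom a -> cinv (cmap a) = a;
  cmap_cont : forall a, cdom a -> {for a, continuous cmap};
  cinv_cont : forall x, (cmap @` cdom) x -> {for x, continuous cinv} }.

Definition cimg (R : realType) (d : nat) (T : topologicalType)
  (c : chart R d T) : set 'rV[R]_d := cmap c @` cdom c.

Definition compatible (R : realType) (d : nat) (T : topologicalType)
    (c c' : chart R d T) : Prop :=
  smooth_on (cmap c @` (cdom c `&` cdom c')) (cmap c' \o cinv c) /\
  smooth_on (cmap c' @` (cdom c `&` cdom c')) (cmap c \o cinv c').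

Record manifold (R : realType) (d : nat) := Manifold {
  mcarrier :> topologicalType;
  mhausdorff : hausdorff_space mcarrier;
  mcountable : @second_countable mcarrier;
  atlas : set (chart R d mcarrier);
  atlas_cover : forall a, exists2 c, atlas c & cdom c a;
  atlas_compat : forall c c', atlas c -> atlas c' -> compatible c c' }.

(* Local coordinate systems: the charts of the maximal atlas. *)
Definition coordinates (R : realType) (d : nat) (M : manifold R d)
    (c : chart R d M) : Prop := forall c', atlas c' -> compatible c c'.

Definition lrep (R : realType) (d e : nat) (M : manifold R d)
    (N : manifold R e) (c : chart R d M) (c' : chart R e N) (f : M -> N) :
    'rV[R]_d -> 'rV[R]_e := cmap c' \o f \o cinv c.

Definition smooth_map (R : realType) (d e : nat) (M : manifold R d)
    (N : manifold R e) (f : M -> N) : Prop :=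
  continuous f /\
  forall c c', coordinates c -> coordinates c' ->
    smooth_on (cmap c @` (cdom c `&` f @^-1` cdom c')) (lrep c c' f).

(* [f], as a map on the product manifold [A * B], is smooth; the product
   charts are indexed by pairs of charts. *)
Definition smooth_map2 (R : realType) (a b d : nat) (A : manifold R a)
    (B : manifold R b) (C : manifold R d) (f : A -> B -> C) : Prop :=
  continuous (fun x : A * B => f x.1 x.2) /\
  forall cA cB cC, coordinates cA -> coordinates cB -> coordinates cC ->
    smooth_on
      [set w : 'rV[R]_(a + b) | [/\ cimg cA (lsubmx w), cimg cB (rsubmx w) &
         cdom cC (f (cinv cA (lsubmx w)) (cinv cB (rsubmx w)))]]
      (fun w => cmap cC (f (cinv cA (lsubmx w)) (cinv cB (rsubmx w)))).

Definition constant_rank (R : realType) (d e : nat) (M : manifold R d)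
    (N : manifold R e) (f : M -> N) : Prop :=
  exists r : nat, forall a c c', coordinates c -> coordinates c' ->
    cdom c a -> cdom c' (f a) ->
    \rank (jacobian (lrep c c' f) (cmap c a)) = r.

Record lieGroup (R : realType) (d : nat) := LieGroup {
  gcarrier :> manifold R d;
  gmul : gcarrier -> gcarrier -> gcarrier;
  gone : gcarrier;
  ginv : gcarrier -> gcarrier;
  gmulA : associative gmul;
  gmul1 : left_id gone gmul;
  gmulV : left_inverse gone ginv gmul;
  gmul_smooth : smooth_map2 gmul;
  ginv_smooth : smooth_map ginv }.

Record smooth_action (R : realType) (d m : nat) (G : lieGroup R d)
    (M : manifold R m) (act : G -> M -> M) : Prop := SmoothAction {
  act_smooth : smooth_map2 act;
  act1 : forall z, act (gone G) z = z;
  actM : forall g h z, act (gmul g h) z = act g (act h z) }.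

Definition projectable (R : realType) (d m n : nat) (G : lieGroup R d)
    (M : manifold R m) (N : manifold R n) (act : G -> M -> M) (Pi : M -> N) :
    Prop :=
  forall (v : N) (g : G), exists v' : N,
    act g @` (Pi @^-1` [set v]) = Pi @^-1` [set v'].

(* [g . v]; the default value [v] of [xget] is irrelevant when the action is
   projectable, and then the image is unique when [Pi] is surjective. *)
Definition induced_action (R : realType) (d m n : nat) (G : lieGroup R d)
    (M : manifold R m) (N : manifold R n) (act : G -> M -> M) (Pi : M -> N)
    (g : G) (v : N) : N :=
  xget v [set v' | act g @` (Pi @^-1` [set v]) = Pi @^-1` [set v']].

(* J^oo is the projective limit of the J^k.  Over a chart of a manifold of
   dimension [p + q], whose first [p] coordinates x are the independent
   variables and whose last [q] coordinates u are the dependent ones, a point of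
   J^oo is given by the values of the x^i (index [inl i]) and of the derivatives
   u^al_J (index [inr (al, J)], where [J i] is the number of differentiations
   with respect to x^i). *)
Definition midx (p : nat) := {ffun 'I_p -> nat}.

Definition midx0 (p : nat) : midx p := [ffun=> 0%N].

Definition midxS (p : nat) (J : midx p) (i : 'I_p) : midx p :=
  [ffun j => (J j + (j == i))%N].

Definition jidx (p q : nat) := ('I_p + 'I_q * midx p)%type.

Definition jorder (p q : nat) (A : jidx p q) : nat :=
  match A with inl _ => 0%N | inr (_, J) => (\sum_i J i)%N end.

Definition jet (R : realType) (p q : nat) := jidx p q -> R.

Definition jbase (R : realType) (p q : nat) (z : jet R p q) : 'rV[R]_(p + q) :=
  row_mx (\row_i z (inl i)) (\row_al z (inr (al, midx0 p))).

Definition jets_over (R : realType) (p q : nat) (M : manifold R (p + q))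
  (c : chart R (p + q) M) : set (jet R p q) := [set z | cimg c (jbase z)].

Definition pderiv (R : realType) (p q : nat) (J : midx p)
    (f : 'rV[R]_p -> 'rV[R]_q) : 'rV[R]_p -> 'rV[R]_q :=
  foldr (fun i h => iter (J i) (fun h' x => 'D_(delta_mx 0 i) h' x) h) f
        (enum 'I_p).

(* The prolongation x |-> j_oo S of the submanifold S = {u = f(x)}. *)
Definition jet_graph (R : realType) (p q : nat) (f : 'rV[R]_p -> 'rV[R]_q)
    (x : 'rV[R]_p) : jet R p q :=
  fun A => match A with
           | inl i => x 0 i
           | inr (al, J) => pderiv J f x 0 al
           end.

(* Near its point [a], the set [S] is the graph u = f(x): it is a
   [p]-dimensional submanifold there, transverse to the fibres x = constant. *)
Definition local_graph (R : realType) (p q : nat) (M : manifold R (p + q))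
    (c : chart R (p + q) M) (S : set M) (a : M) (f : 'rV[R]_p -> 'rV[R]_q) :
    Prop :=
  [/\ S a, cdom c a, smooth_near (lsubmx (cmap c a)) f &
      \forall b \near a, S b <-> rsubmx (cmap c b) = f (lsubmx (cmap c b))].

(* [z] agrees up to order [k] with the coordinates of the jet of [S] at [a]. *)
Definition is_jet (R : realType) (p q : nat) (M : manifold R (p + q))
    (c : chart R (p + q) M) (k : nat) (S : set M) (a : M) (z : jet R p q) :
    Prop :=
  exists2 f, local_graph c S a f &
    forall A, (jorder A <= k)%N -> z A = jet_graph f (lsubmx (cmap c a)) A.

(* The tangent space of [S] at [a], in coordinates. *)
Definition tangent (R : realType) (p q : nat) (M : manifold R (p + q))
    (c : chart R (p + q) M) (S : set M) (a : M) : set 'rV[R]_(p + q) :=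
  [set t | exists2 f, local_graph c S a f &
     exists h : 'rV[R]_p, t = row_mx h ('d f (lsubmx (cmap c a)) h)].

(* [T_a S] meets the kernel of [d Phi] trivially. *)
Definition regular (R : realType) (p q s : nat) (M : manifold R (p + q))
    (N : manifold R (p + s)) (c : chart R (p + q) M) (c' : chart R (p + s) N)
    (Phi : M -> N) (S : set M) (a : M) : Prop :=
  forall t, tangent c S a t -> 'd (lrep c c' Phi) (cmap c a) t = 0 -> t = 0.

(* Phi^(k) (j_k S | a) = j_k (Phi S) | Phi a. *)
Definition prolongs_upto (R : realType) (p q s : nat) (M : manifold R (p + q))
    (N : manifold R (p + s)) (c : chart R (p + q) M) (c' : chart R (p + s) N)
    (Phi : M -> N) (k : nat) (z : jet R p q) (w : jet R p s) : Prop :=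
  exists S a, [/\ is_jet c k S a z, regular c c' Phi S a &
                  is_jet c' k (Phi @` S) (Phi a) w].

Definition prolongs (R : realType) (p q s : nat) (M : manifold R (p + q))
    (N : manifold R (p + s)) (c : chart R (p + q) M) (c' : chart R (p + s) N)
    (Phi : M -> N) (z : jet R p q) (w : jet R p s) : Prop :=
  forall k, prolongs_upto c c' Phi k z w.

(* Phi^(oo) as a function; 0 where it is undefined. *)
Definition prolong (R : realType) (p q s : nat) (M : manifold R (p + q))
    (N : manifold R (p + s)) (c : chart R (p + q) M) (c' : chart R (p + s) N)
    (Phi : M -> N) (z : jet R p q) : jet R p s :=
  xget (fun=> 0) [set w | prolongs c c' Phi z w].

(* The finitely many jet coordinates of order at most [k]. *)
Definition jidxk (p q k : nat) : finType :=
  ('I_p + 'I_q *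
     {J : {ffun 'I_p -> 'I_k.+1} | (\sum_i (J i : nat) <= k)%N})%type.

Definition jidxk_val (p q k : nat) (A : jidxk p q k) : jidx p q :=
  match A with
  | inl i => inl i
  | inr (al, J) => inr (al, [ffun i => val (sval J i)])
  end.

Definition jtrunc (R : realType) (p q k : nat) (z : jet R p q) :
    'rV[R]_#|jidxk p q k| := \row_A z (jidxk_val (enum_val A)).

(* [F], with domain [E], is a smooth function on an open subset of the part of
   J^k over the chart [c]; the values of [F] off [E] are irrelevant. *)
Definition differential_function_of_order (R : realType) (p q : nat)
    (M : manifold R (p + q)) (c : chart R (p + q) M) (k : nat)
    (E : set (jet R p q)) (F : jet R p q -> R) : Prop :=
  E `<=` jets_over c /\
  exists (U : set 'rV[R]_#|jidxk p q k|) (f : 'rV[R]_#|jidxk p q k| -> R),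
    [/\ open U, E = @jtrunc R p q k @^-1` U, smooth_on U f &
        forall z, E z -> F z = f (jtrunc k z)].

Definition differential_function (R : realType) (p q : nat)
    (M : manifold R (p + q)) (c : chart R (p + q) M) (E : set (jet R p q))
    (F : jet R p q -> R) : Prop :=
  exists k, differential_function_of_order c k E F.

(* A one-form takes a point and a tangent vector (the family of its components
   along the jet coordinates). *)
Definition oneform (R : realType) (p q : nat) := jet R p q -> jet R p q -> R.

Definition dform (R : realType) (p q : nat) (F : jet R p q -> R) : oneform R p q :=
  fun z X => derive1 (fun t : R => F (fun A => z A + t * X A)) 0.

Definition pullback (R : realType) (p q s : nat)
    (Psi : jet R p q -> jet R p s) (th : oneform R p s) : oneform R p q :=
  fun z X => th (Psi z) (fun A => dform (fun z' => Psi z' A) z X).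

(* sum_i (q i) dx^i *)
Definition hform (R : realType) (p q : nat) (Q : 'I_p -> jet R p q -> R) :
    oneform R p q := fun z X => \sum_i Q i z * X (inl i).

(* [th] vanishes on restriction to the prolongation of every submanifold
   u = f(x), at the points of that prolongation lying in [E]. *)
Definition contact_on (R : realType) (p q : nat) (E : set (jet R p q))
    (th : oneform R p q) : Prop :=
  forall (f : 'rV[R]_p -> 'rV[R]_q) (x : 'rV[R]_p),
    smooth_near x f -> E (jet_graph f x) ->
    forall i : 'I_p, th (jet_graph f x)
      (fun A => 'D_(delta_mx 0 i) (fun y => jet_graph f y A : R) x) = 0.

(* D_i = d/dx^i + sum_(al, J) u^al_(J + i) d/du^al_J *)
Definition total_vector (R : realType) (p q : nat) (i : 'I_p) (z : jet R p q) :
    jet R p q :=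
  fun A => match A with
           | inl j => (j == i)%:R
           | inr (al, J) => z (inr (al, midxS J i))
           end.

(* As du^al_J = (contact form) + sum_i u^al_(J + i) dx^i, the dx^i-coefficient
   of the horizontal component of [th] is the value of [th] on D_i. *)
Definition hcoef (R : realType) (p q : nat) (th : oneform R p q) (i : 'I_p) :
    jet R p q -> R := fun z => th z (total_vector i z).

Definition piH (R : realType) (p q : nat) (th : oneform R p q) : oneform R p q :=
  hform (hcoef th).

Definition dH (R : realType) (p q : nat) (F : jet R p q -> R) : oneform R p q :=
  piH (dform F).

(* The coframe om^i = sum_j (Q i j) dx^j on the open subset [D]. *)
Definition horizontal_coframe (R : realType) (p q : nat)
    (M : manifold R (p + q)) (c : chart R (p + q) M) (D : set (jet R p q))
    (Q : 'I_p -> 'I_p -> jet R p q -> R) : Prop :=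
  (forall i j, differential_function c D (Q i j)) /\
  (forall z, D z -> row_free (\matrix_(i, j) Q i j z)).

(* The pull-back of each om^i under the prolongation of each transformation in
   [Gam] agrees with om^i modulo contact forms, wherever both are defined.
   Prolonging and pulling back requires the transformations to be smooth. *)
Definition contact_invariant (R : realType) (p q : nat)
    (M : manifold R (p + q)) (c : chart R (p + q) M) (Gam : set (M -> M))
    (D : set (jet R p q)) (Q : 'I_p -> 'I_p -> jet R p q -> R) : Prop :=
  forall phi, Gam phi -> smooth_map phi /\
    forall i, contact_on
      [set z | D z /\ exists2 w, prolongs c c phi z w & D w]
      (fun z X => pullback (prolong c c phi) (hform (Q i)) z X
                  - hform (Q i) z X).

(* d_H F = sum_j (DD_j F) om^j for every differential function F. *)
Definition dual_operators (R : realType) (p q : nat) (M : manifold R (p + q))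
    (c : chart R (p + q) M) (D : set (jet R p q))
    (Q : 'I_p -> 'I_p -> jet R p q -> R)
    (DD : 'I_p -> (jet R p q -> R) -> (jet R p q -> R)) : Prop :=
  forall E F, differential_function c E F -> forall z, D z -> E z ->
    forall X, dH F z X = \sum_j DD j F z * hform (Q j) z X.

Definition partial (R : realType) (d e : nat) (f : 'rV[R]_d -> 'rV[R]_e)
    (k : 'I_e) (i : 'I_d) (x : 'rV[R]_d) : R :=
  'D_(delta_mx 0 i) (fun y => f y 0 k : R) x.

(* D_0 Pi = (D_i Pi^k)_(i, k = 1..p) *)
Definition D0 (R : realType) (p q s : nat) (M : manifold R (p + q))
    (N : manifold R (p + s)) (c : chart R (p + q) M) (c' : chart R (p + s) N)
    (Pi : M -> N) (z : jet R p q) : 'M[R]_p :=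
  \matrix_(i, k)
    (partial (lrep c c' Pi) (lshift s k) (lshift q i) (jbase z) +
     \sum_al z (inr (al, midxS (midx0 p) i)) *
             partial (lrep c c' Pi) (lshift s k) (rshift p al) (jbase z)).

(* The jets projecting into [D] at which the non-singularity condition
   det D_0 Pi <> 0 holds. *)
Definition nonsingular_preimage (R : realType) (p q s : nat)
    (M : manifold R (p + q)) (N : manifold R (p + s)) (c : chart R (p + q) M)
    (c' : chart R (p + s) N) (Pi : M -> N) (D : set (jet R p s)) :
    set (jet R p q) :=
  [set z | [/\ jets_over c z, cdom c' (Pi (cinv c (jbase z))),
               \det (D0 c c' Pi z) != 0 & D (prolong c c' Pi z)]].

(* The coefficients of the horizontal components of the pull-backs Pi^* om^i. *)
Definition coframe_hat (R : realType) (p q s : nat) (M : manifold R (p + q))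
    (N : manifold R (p + s)) (c : chart R (p + q) M) (c' : chart R (p + s) N)
    (Pi : M -> N) (Q : 'I_p -> 'I_p -> jet R p s -> R) :
    'I_p -> 'I_p -> jet R p q -> R :=
  fun i j => hcoef (pullback (prolong c c' Pi) (hform (Q i))) j.

(* Main.v *)
(* In the chosen coordinates the prolongation of Pi is given by an explicit
   recursion: on the jets where D_0 Pi is invertible, if [w] is the image of
   [z], then [w_(J + l) = sum_i (D_0 Pi)^-1_(l i) D_i w_J].  For a graph
   u = f(x) whose image under Pi is the graph v = h(y), repeated
   differentiation of h(y(x)) = v(x) shows that the derivatives of h obey the
   recursion, so the prolongation is unique.  For existence at an arbitrary jet,
   a Taylor polynomial realises the jet up to any given order, and the inverse
   function theorem applied to x |-> y(x) makes its image a graph.  Hence the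
   prolongation is a smooth function of finitely many jet coordinates at each
   order, and maps D_i to [sum_l (D_0 Pi)_(i l) D_l].  Consequently the
   coefficient matrix of the lifted coframe is [Q (D_0 Pi)^T], and the chain
   rule gives D_i (F o Pi) = [sum_l (D_0 Pi)_(i l)] (D_l F) o Pi, which is the
   asserted identity once both sides are expanded in the dual operators.
   Contact invariance is the matrix identity
   D_0 g * D_0 Pi = D_0 Pi * D_0 [g], obtained by differentiating
   Pi o g = [g] o Pi along a graph. *)
Require Import Defs.
From HB Require Import structures.
From mathcomp Require Import all_boot all_order all_algebra.
From mathcomp Require Import all_classical all_reals all_analysis.
From mathcomp Require Import ring lra.
Import Order.TTheory GRing.Theory Num.Theory numFieldNormedType.Exports.

Set Implicit Arguments.
Unset Strict Implicit.
Unset Printing Implicit Defensive.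

Local Open Scope classical_set_scope.
Local Open Scope ring_scope.

(** * Calculus of C^k maps *)

(** No norm is used on the infinite product [jet]: all analysis takes place on truncated jets, where
    a function of finite order is read along the section [jext k], and every identity involves jet
    coordinates only up to an explicit order. This finiteness does two jobs. The definition of
    [prolongs] allows a different germ of submanifold for each order [k], so no single germ
    determines the image; what ties the germs together is that each coordinate of [pjet] depends on
    finitely many coordinates of the jet. Formal computations with total derivatives are replaced in
    the same way: an identity at a jet is checked on a polynomial graph having the same jet to a
    high enough order, where total derivatives are ordinary partial derivatives and the chain rule
    applies. The condition det D_0 Pi != 0 is exactly what the geometric definition yields: it
    combines [regular] with the requirement that the image be a graph over the first [p] coordinates
    of the target chart. *)

Section Calculus.
Variable R : realType.
Implicit Types V W : normedModType R.

Lemma near_addr0 V (P : set V) (x : V) :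
  (\forall y \near x, P y) -> \forall h \near (0 : V), P (h + x).
Proof.
move=> Px; have : (fun h : V => h + x) h @[h --> (0 : V)] --> (0 : V) + x.
  by apply: cvgD; [exact: cvg_id | exact: cvg_cst].
by rewrite add0r; apply.
Qed.

(** The first-order expansion of [f] at [x] is also one of [g], because only values near [x] enter;
    [diff_unique] then identifies the differential. *)
Lemma differentiable_near_eq V W (f g : V -> W) (x : V) :
  {near x, f =1 g} -> differentiable f x -> differentiable g x.
Proof.
move=> fg df.
have dc : continuous ('d f x) by exact: diff_continuous.
have E : g \o shift x = cst (g x) + 'd f x +o_ 0 id.
  apply/eqaddoP => e e0.
  have /eqaddoP/(_ e e0) He := diff_locally df.
  near=> h.
  have <- : (f \o shift x - (cst (f x) + 'd f x)) h =
            (g \o shift x - (cst (g x) + 'd f x)) h.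
    rewrite !fctE /= (nbhs_singleton fg); congr (_ - _).
    by near: h; exact: (near_addr0 fg).
  by near: h.
by apply/diff_locallyP; rewrite (diff_unique dc E).
Unshelve. all: by end_near. Qed.

Lemma differentiable_bound V W (f : V -> W) (L : {linear V -> W}) (x : V) :
  continuous L ->
  (forall e, 0 < e -> \forall h \near (0 : V),
     `|f (h + x) - f x - L h| <= e * `|h|) -> differentiable f x.
Proof.
move=> Lc H.
have E : f \o shift x = cst (f x) + L +o_ 0 id.
  apply/eqaddoP => e e0; near=> h.
  rewrite !fctE /= opprD addrA.
  by near: h; exact: H.
by apply/diff_locallyP; rewrite (diff_unique Lc E).
Unshelve. all: by end_near. Qed.

Lemma continuous_near_eq V W (f g : V -> W) (x : V) :
  {near x, f =1 g} -> {for x, continuous f} -> {for x, continuous g}.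
Proof.
move=> fg fc; rewrite /prop_for /continuous_at -(nbhs_singleton fg).
by apply: cvg_trans fc; apply: near_eq_cvg; apply: filterS fg => y /esym.
Qed.

Lemma open_near V (U : set V) (P : V -> Prop) (x : V) :
  open U -> U x -> (forall y, U y -> P y) -> \forall y \near x, P y.
Proof. by move=> oU Ux UP; apply: (filterS UP); exact: open_nbhs_nbhs. Qed.

Lemma derive_ext V W (f g : V -> W) (v x : V) :
  f =1 g -> 'D_v f x = 'D_v g x.
Proof. by move=> /funext ->. Qed.

(** Openness of [U] turns equality on [U] into equality near each point, hence into equality of
    derivatives. The closure lemmas below rest on this: on [U] a derivative is replaced by an
    expression already known to be of class C^k. *)
Lemma Ck_eq V W k (U : set V) (f g : V -> W) :
  open U -> (forall x, U x -> f x = g x) -> Ck k U f -> Ck k U g.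
Proof.
elim: k f g => [|k IH] f g oU fg /=.
  move=> fc x Ux; apply: continuous_near_eq (fc x Ux).
  exact: (open_near oU Ux).
move=> [df cf]; split.
  move=> x Ux; apply: differentiable_near_eq (df x Ux).
  exact: (open_near oU Ux).
move=> v; apply: IH (cf v) => // x Ux; apply: near_eq_derive.
exact: (open_near oU Ux).
Qed.

Lemma Ck_sub V W k (U U' : set V) (f : V -> W) :
  U' `<=` U -> Ck k U f -> Ck k U' f.
Proof.
elim: k f => [|k IH] f sU /=; first by move=> h x /sU; exact: h.
by move=> [df cf]; split=> [x /sU|v]; [exact: df | exact: IH].
Qed.

Lemma CkS V W k (U : set V) (f : V -> W) : Ck k.+1 U f -> Ck k U f.
Proof.
elim: k f => [|k IH] f [df cf].
  by move=> x Ux; exact/differentiable_continuous/df.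
by split=> // v; exact: IH.
Qed.

Lemma Ck_cst V W k (U : set V) (a : W) : Ck k U (cst a).
Proof.
elim: k a => [|k IH] a /=; first by move=> x _; exact: cst_continuous.
split=> [x _|v]; first exact: differentiable_cst.
by have -> : (fun x => 'D_v (cst a) x) = cst 0
  by apply/funext => x; rewrite derive_cst.
Qed.

Lemma CkD V W k (U : set V) (f g : V -> W) :
  open U -> Ck k U f -> Ck k U g -> Ck k U (fun x => f x + g x).
Proof.
elim: k f g => [|k IH] f g oU /=.
  by move=> cf cg x Ux; apply: cvgD; [exact: cf | exact: cg].
move=> [df cf] [dg cg]; split.
  by move=> x Ux; apply: differentiableD; [exact: df | exact: dg].
move=> v; apply: Ck_eq (IH _ _ oU (cf v) (cg v)) => // x Ux.
by rewrite -deriveD//; apply: diff_derivable; [exact: df | exact: dg].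
Qed.

Lemma CkM V k (U : set V) (f g : V -> R) :
  open U -> Ck k U f -> Ck k U g -> Ck k U (fun x => f x * g x).
Proof.
elim: k f g => [|k IH] f g oU.
  by move=> cf cg x Ux; apply: cvgM; [exact: cf | exact: cg].
move=> cf cg; move: (cf) (cg) => [df dcf] [dg dcg]; split.
  by move=> x Ux; apply: differentiableM; [exact: df | exact: dg].
move=> v.
have h1 := IH _ _ oU (CkS cf) (dcg v); have h2 := IH _ _ oU (CkS cg) (dcf v).
apply: Ck_eq (CkD oU h1 h2) => // x Ux.
by rewrite deriveM//; apply: diff_derivable; [exact: df | exact: dg].
Qed.

Lemma CkN V k (U : set V) (f : V -> R) :
  open U -> Ck k U f -> Ck k U (fun x => - f x).
Proof.
move=> oU cf; apply: Ck_eq (CkM oU (Ck_cst k U (-1 : R)) cf) => // x _ /=.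
by rewrite mulN1r.
Qed.

(** The derivative of 1/f is -(1/f)^2 Df, so the induction hypothesis is applied to 1/f itself, with
    [f] fixed. *)
Lemma CkV V k (U : set V) (f : V -> R) :
  open U -> (forall x, U x -> f x != 0) -> Ck k U f ->
  Ck k U (fun x => (f x)^-1).
Proof.
move=> oU f0; elim: k => [|k IH].
  by move=> cf x Ux; apply: cvgV; [exact: f0 | exact: cf].
move=> cf; move: (cf) => [df dcf]; split.
  by move=> x Ux; apply: differentiableV; [exact: df | exact: f0].
move=> v; have hV := IH (CkS cf).
apply: Ck_eq (CkN oU (CkM oU (CkM oU hV hV) (dcf v))) => // x Ux.
rewrite deriveV ?f0//; last by apply/diff_derivable/df.
by rewrite /GRing.scale/= -expr2 -exprVn exprVn mulNr.
Qed.

Lemma Ck_sum V k (U : set V) (I : Type) (r : seq I) (P : pred I)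
    (f : I -> V -> R) :
  open U -> (forall i, P i -> Ck k U (f i)) ->
  Ck k U (fun x => \sum_(i <- r | P i) f i x).
Proof.
move=> oU cf; elim: r => [|i r IH].
  by apply: Ck_eq (Ck_cst k U (0 : R)) => // x _; rewrite big_nil.
have [Pi|nPi] := boolP (P i).
  by apply: Ck_eq (CkD oU (cf i Pi) IH) => // x _; rewrite big_cons Pi.
by apply: Ck_eq IH => // x _; rewrite big_cons (negPf nPi).
Qed.

Lemma Ck_prod V k (U : set V) (I : Type) (r : seq I) (P : pred I)
    (f : I -> V -> R) :
  open U -> (forall i, P i -> Ck k U (f i)) ->
  Ck k U (fun x => \prod_(i <- r | P i) f i x).
Proof.
move=> oU cf; elim: r => [|i r IH].
  by apply: Ck_eq (Ck_cst k U (1 : R)) => // x _; rewrite big_nil.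
have [Pi|nPi] := boolP (P i).
  by apply: Ck_eq (CkM oU (cf i Pi) IH) => // x _; rewrite big_cons Pi.
by apply: Ck_eq IH => // x _; rewrite big_cons (negPf nPi).
Qed.

Lemma is_derive_coord n (x v : 'rV[R]_n) (i : 'I_n) :
  is_derive x v (fun y => y 0 i : R) (v 0 i).
Proof.
apply: DeriveDef; first exact/diff_derivable/differentiable_coord.
have := derive_mx (@derivable_id _ 'rV[R]_n x v); rewrite derive_id => /rowP/(_ i).
by rewrite mxE.
Qed.

Lemma Ck_coord n k (U : set 'rV[R]_n) (i : 'I_n) :
  Ck k U (fun x => x 0 i : R).
Proof.
case: k => [|k]; first by move=> x _; exact: coord_continuous.
split=> [x _|v]; first exact: differentiable_coord.
rewrite (_ : 'D_v _ = cst (v 0 i)); last first.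
  by apply/funext => x; exact: (@derive_val _ _ _ _ _ _ _ (is_derive_coord x v i)).
exact: Ck_cst.
Qed.

Lemma differentiable_row V n (f : V -> 'rV[R]_n) (x : V) :
  differentiable f x <-> forall j, differentiable (fun y => f y 0 j : R) x.
Proof.
split=> [df j|df].
  exact: (differentiable_comp df (differentiable_coord (f x) 0 j)).
have -> : f = \sum_(j < n) (fun y => (f y 0 j : R) *: (delta_mx 0 j : 'rV[R]_n)).
  by apply/funext => y; rewrite fct_sumE {1}[f y]row_sum_delta.
by apply: differentiable_sum => j; exact/differentiableZl/df.
Qed.

Lemma derive_row V n (f : V -> 'rV[R]_n) (x v : V) (j : 'I_n) :
  differentiable f x -> ('D_v f x) 0 j = 'D_v (fun y => f y 0 j : R) x.
Proof. by move=> df; rewrite derive_mx ?mxE//; exact: diff_derivable. Qed.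

Lemma continuous_row (T : topologicalType) n (f : T -> 'rV[R]_n) (x : T) :
  {for x, continuous f} <-> forall j, {for x, continuous (fun y => f y 0 j : R)}.
Proof.
split=> [cf j|cf].
  exact: (continuous_comp cf (@coord_continuous _ _ _ 0 j (f x))).
apply/cvgrPdist_lt => e e0; near=> y.
have : ball (f x) e (f y).
  split=> // i; rewrite ord1; near: y; apply: filter_forall => j.
  by apply: ((cvgrPdist_lt _ _).1 (cf j)).
by rewrite -ball_normE.
Unshelve. all: by end_near. Qed.

Lemma Ck_row V n k (U : set V) (f : V -> 'rV[R]_n) : open U ->
  Ck k U f <-> forall j, Ck k U (fun y => f y 0 j : R).
Proof.
move=> oU; elim: k f => [|k IH] f.
  split=> [cf j x Ux|cf x Ux]; first by move/continuous_row: (cf x Ux).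
  by apply/continuous_row => j; exact: cf.
split=> [[df cf] j|cf]; split.
- by move=> x Ux; move/differentiable_row: (df x Ux).
- move=> v; move/IH: (cf v) => /(_ j); apply: Ck_eq => // x Ux.
  by apply: derive_row; exact: df.
- by move=> x Ux; apply/differentiable_row => j; exact: (cf j).1.
- move=> v; apply/IH => j; apply: Ck_eq ((cf j).2 v) => // x Ux.
  by rewrite derive_row//; apply/differentiable_row => i; exact: (cf i).1.
Qed.

Lemma derive_partials n (g : 'rV[R]_n -> R) (a v : 'rV[R]_n) :
  differentiable g a ->
  'D_v g a = \sum_j v 0 j * 'D_(delta_mx 0 j) g a.
Proof.
move=> dg; rewrite deriveE// {1}[v]row_sum_delta linear_sum.
by apply: eq_bigr => j _; rewrite linearZ deriveE.
Qed.

Lemma derive_chain V n (W : normedModType R) (f : V -> 'rV[R]_n)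
    (g : 'rV[R]_n -> W) (x v : V) :
  differentiable f x -> differentiable g (f x) ->
  'D_v (g \o f) x = 'D_('D_v f x) g (f x).
Proof.
move=> df dg; rewrite !deriveE//; last exact: differentiable_comp.
by rewrite diff_comp.
Qed.

(** By the chain rule D_v (g o f) = sum_j (D_v f)_j (d_j g) o f. The induction runs over all [g],
    since the partial derivatives of [g] take its place. *)
Lemma Ck_comp_scalar V n k (U : set V) (U' : set 'rV[R]_n)
    (f : V -> 'rV[R]_n) (g : 'rV[R]_n -> R) :
  open U -> (forall x, U x -> U' (f x)) ->
  Ck k U f -> Ck k U' g -> Ck k U (g \o f).
Proof.
move=> oU fU; elim: k g => [|k IH] g cf cg.
  by move=> x Ux; apply: continuous_comp; [exact: cf | exact/cg/fU].
move: (cf) (cg) => [df dcf] [dg dcg]; split.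
  by move=> x Ux; apply: differentiable_comp; [exact: df | exact/dg/fU].
move=> v; apply: (@Ck_eq _ _ _ _ (fun x => \sum_j ('D_v f x) 0 j *
    ('D_(delta_mx 0 j) g \o f) x)) => //.
  move=> x Ux; rewrite derive_chain; [|exact: df|exact/dg/fU].
  by rewrite derive_partials//; exact/dg/fU.
apply: Ck_sum => // j _; apply: CkM => //.
  by move: j; apply/(Ck_row _ _ oU)/dcf.
exact: (IH _ (CkS cf) (dcg _)).
Qed.

Lemma Ck_comp V n m k (U : set V) (U' : set 'rV[R]_n)
    (f : V -> 'rV[R]_n) (g : 'rV[R]_n -> 'rV[R]_m) :
  open U -> open U' -> (forall x, U x -> U' (f x)) ->
  Ck k U f -> Ck k U' g -> Ck k U (g \o f).
Proof.
move=> oU oU' fU cf /Ck_row cg; apply/Ck_row => // j.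
exact: (Ck_comp_scalar oU fU cf (cg oU' j)).
Qed.

Lemma Ck_det V n k (U : set V) (A : V -> 'M[R]_n) :
  open U -> (forall i j, Ck k U (fun x => A x i j : R)) ->
  Ck k U (fun x => \det (A x)).
Proof.
move=> oU cA; apply: Ck_sum => // s _; apply: CkM => //; first exact: Ck_cst.
by apply: Ck_prod.
Qed.

Lemma Ck_invmx V n k (U : set V) (A : V -> 'M[R]_n) :
  open U -> (forall x, U x -> \det (A x) != 0) ->
  (forall i j, Ck k U (fun x => A x i j : R)) ->
  forall i j, Ck k U (fun x => invmx (A x) i j : R).
Proof.
move=> oU A0 cA i j.
(* Cramer's rule: the entry (i, j) of the inverse is the cofactor at (j, i) over the determinant. *)
apply: (@Ck_eq _ _ _ _ (fun x => (\det (A x))^-1 *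
    ((-1) ^+ (j + i) * \det (row' j (col' i (A x)))))) => //.
  move=> x Ux; have uA : A x \in unitmx by rewrite unitmxE unitfE A0.
  by rewrite /invmx uA !mxE.
apply: CkM => //; first by apply: CkV => //; exact: Ck_det.
apply: CkM => //; first exact: Ck_cst.
apply: Ck_det => // a b; apply: Ck_eq (cA (lift j a) (lift i b)) => // x _.
by rewrite !mxE.
Qed.

End Calculus.

(** * Schwarz theorem and inverse function theorem *)

Section InverseFunction.
Variable R : realType.
Implicit Types V W : normedModType R.

Lemma coord_le_norm n (x : 'rV[R]_n) i : `|x 0 i| <= `|x|.
Proof.
rewrite [leRHS]/Num.Def.normr/= mx_normrE.
by apply: le_trans; last exact: (le_bigmax _ _ (ord0, i)).
Qed.

Lemma row_norm_le n (x : 'rV[R]_n) c :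
  0 <= c -> (forall i, `|x 0 i| <= c) -> `|x| <= c.
Proof.
move=> c0 xc; rewrite /Num.Def.normr/= mx_normrE; apply: bigmax_le => //=.
by move=> [i j] _ /=; rewrite ord1.
Qed.

Lemma near_forall (T : topologicalType) (I : finType) (x : T) (P : I -> set T) :
  (forall i, nbhs x (P i)) -> nbhs x [set y | forall i, P i y].
Proof. by move=> H; exact: (@filter_forall _ _ P _ _ H). Qed.

Lemma near_dist (T : topologicalType) V (x : T) (g : T -> V) (e : R) :
  {for x, continuous g} -> 0 < e -> \forall z \near x, `|g x - g z| < e.
Proof. by move=> cg; apply: ((cvgrPdist_lt _ _).1 cg). Qed.

Lemma near_normP V (x : V) (P : set V) :
  nbhs x P <-> exists2 r : R, 0 < r & forall y, `|y - x| < r -> P y.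
Proof.
split=> [/nbhs_ballP[r /= r0 rP]|[r r0 rP]].
  exists r => // y yr; apply: rP; rewrite -ball_normE /ball_ /=.
  by rewrite distrC.
apply/nbhs_ballP; exists r => // y; rewrite -ball_normE /ball_ /= distrC.
exact: rP.
Qed.

Lemma is_derive_line V W (g : V -> W) (x v : V) (t : R) :
  differentiable g (x + t *: v) ->
  is_derive t 1 (fun t : R => g (x + t *: v)) ('D_v g (x + t *: v)).
Proof.
move=> dg; pose l := (cst x : R -> V) + ( *:%R^~ v).
have dl : is_diff t l (0 + ( *:%R^~ v)) by exact: is_diffD.
have ddl : differentiable l t by exact: ex_diff.
apply: DeriveDef.
  by apply: diff_derivable; apply: (differentiable_comp ddl).
rewrite deriveE; last exact: (differentiable_comp ddl dg).
rewrite diff_comp//= deriveE//.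
by congr ('d g _ _); rewrite diff_val /= add0r scale1r.
Qed.

Lemma mean_value V (g : V -> R) (x v : V) :
  (forall t, 0 <= t <= 1 -> differentiable g (x + t *: v)) ->
  exists2 t, 0 <= t <= 1 & g (x + v) - g x = 'D_v g (x + t *: v).
Proof.
move=> dg.
have dl (t : R) : t \in `[0, 1]%R ->
    is_derive t 1 (fun t : R => g (x + t *: v)) ('D_v g (x + t *: v)).
  by rewrite in_itv => /dg/is_derive_line.
have [t t01 E] := @MVT_segment R (fun t => g (x + t *: v))
  (fun t => 'D_v g (x + t *: v)) 0 1 ler01
  (fun t ht => dl t (subset_itv_oo_cc ht))
  (derivable_within_continuous (fun t ht => @ex_derive _ _ _ _ _ _ _ (dl t ht))).
exists t; first by move: t01; rewrite in_itv.
by move: E; rewrite scale0r scale1r addr0 subr0 mulr1.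
Qed.

Lemma near_plane V (P : set V) (x u v : V) : nbhs x P ->
  exists2 r : R, 0 < r & forall a b, 0 <= a <= r -> 0 <= b <= r ->
    P (x + a *: u + b *: v).
Proof.
move=> /nbhs_ballP[e /= e0 eP].
(* The summand 1 keeps the denominator positive when [u] and [v] both vanish. *)
have c0 : 0 < `|u| + `|v| + 1 by rewrite ltr_wpDl// addr_ge0.
exists (e / (`|u| + `|v| + 1)); first exact: divr_gt0.
move=> a b /andP[a0 ar] /andP[b0 br]; apply: eP; rewrite -ball_normE /ball_ /=.
rewrite -addrA opprD addrA subrr sub0r normrN.
apply: le_lt_trans (ler_normD _ _) _; rewrite !normrZ !ger0_norm//.
have : e = e / (`|u| + `|v| + 1) * (`|u| + `|v| + 1) by rewrite divfK ?gt_eqF.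
move=> ->; rewrite !mulrDr mulr1.
apply: (@le_lt_trans _ _ (e / (`|u| + `|v| + 1) * `|u| +
                          e / (`|u| + `|v| + 1) * `|v|)).
  by apply: lerD; rewrite ler_wpM2r.
by rewrite ltrDl divr_gt0.
Qed.

(* Both mixed derivatives approximate the second difference of [f] over a
   small parallelogram, divided by its area [r ^ 2]. *)
Lemma second_difference V (U : set V) (f : V -> R) (x u v : V) (r : R) :
  open U -> Ck 2 U f -> 0 < r ->
  (forall a b, 0 <= a <= r -> 0 <= b <= r -> U (x + a *: u + b *: v)) ->
  exists a b, [/\ 0 <= a <= r, 0 <= b <= r &
    f (x + r *: u + r *: v) - f (x + r *: u) - (f (x + r *: v) - f x) =
    r ^+ 2 * 'D_v ('D_u f) (x + a *: u + b *: v)].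
Proof.
move=> oU cf r0 rU; move: (cf) => [df dcf].
have r00 : 0 <= (0 : R) <= r by rewrite lexx ltW.
have rr : 0 <= r <= r by rewrite ltW//= lexx.
(* The second difference is the increment of [g] along [r *: u]. The mean value theorem is used
   twice: for [g] along [u], then for ['D_u f] along [v]. *)
pose g := (f \o shift (r *: v)) - f.
have tr t : 0 <= t <= 1 -> 0 <= t * r <= r.
  move=> /andP[t0 t1]; rewrite mulr_ge0 ?(ltW r0)//=.
  by rewrite -[leRHS]mul1r ler_wpM2r// ltW.
have Ux a : 0 <= a <= r -> U (x + a *: u).
  by move=> ha; have := rU a 0 ha r00; rewrite scale0r addr0.
have dsh y : U (y + r *: v) -> is_derive y u (f \o shift (r *: v))
    ('D_u f (y + r *: v)).
  move=> Uy.
  have dsh : is_diff y (shift (r *: v)) (id + 0).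
    by apply: is_diffD.
  apply: DeriveDef.
    apply: diff_derivable; apply: differentiable_comp; first exact: ex_diff.
    exact: df.
  rewrite deriveE; last first.
    by apply: differentiable_comp; [exact: ex_diff|exact: df].
  rewrite diff_comp//; last exact: df.
  by rewrite /= diff_val /= addr0 -deriveE//; exact: df.
have dg t : 0 <= t <= 1 -> differentiable g (x + t *: (r *: u)).
  move=> /tr tr'; rewrite scalerA; apply: differentiableB; last exact/df/Ux.
  apply: differentiable_comp; last exact/df/rU.
  by apply: ex_diff; apply: is_diffD.
have [t t01 Et] := mean_value dg; have ht := tr t t01.
pose y := x + (t * r) *: u.
have DZ z w : U z -> 'D_(r *: w) f z = r * 'D_w f z.
  by move=> Uz; rewrite !deriveE ?linearZ//; exact: df.
have d2 t' : 0 <= t' <= 1 -> differentiable ('D_u f) (y + t' *: (r *: v)).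
  by move=> /tr ht'; rewrite scalerA; apply: (dcf u).1; exact: rU.
have [t' /tr ht' Et'] := mean_value d2.
exists (t * r), (t' * r); split => //.
have -> : f (x + r *: u + r *: v) - f (x + r *: u) - (f (x + r *: v) - f x) =
  g (x + r *: u) - g x by [].
have dgy : differentiable g y by rewrite /y -scalerA; exact: dg.
rewrite Et scalerA -/y.
have -> : 'D_(r *: u) g y = r * ('D_u f (y + r *: v) - 'D_u f y).
  rewrite deriveE// linearZ -deriveE//; congr (_ * _).
  have Uyv : U (y + r *: v) by exact: rU.
  rewrite deriveB//; last by apply: diff_derivable; exact/df/Ux.
    by rewrite (@derive_val _ _ _ _ _ _ _ (dsh _ Uyv)).
  exact: (@ex_derive _ _ _ _ _ _ _ (dsh _ Uyv)).
have d2' : differentiable ('D_u f) (y + (t' * r) *: v).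
  by apply: (dcf u).1; exact: rU.
rewrite Et' scalerA deriveE// linearZ -deriveE//.
by rewrite expr2 -mulrA.
Qed.

(** The second difference is symmetric in [u] and [v]. Hence, for small [r], one mixed derivative at
    some point of the parallelogram equals the other at a second point, and by continuity each is
    within e / 2 of its value at [x]. *)
Lemma derive_comm V (U : set V) (f : V -> R) (x u v : V) :
  open U -> U x -> Ck 2 U f -> 'D_v ('D_u f) x = 'D_u ('D_v f) x.
Proof.
move=> oU Ux cf.
have diff_swap (k l m n : R) : k - l - (m - n) = k - m - (l - n) by ring.
have close (k l m n e : R) : m = n -> `|k - m| < e / 2 -> `|l - n| < e / 2 ->
    `|k - l| <= e.
  move=> -> km lm; rewrite -(subrKA n) (splitr e) (le_trans (ler_normD _ _))//.
  by rewrite lerD// ltW// distrC.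
have cancel (k l m r : R) : 0 < r -> m = r ^+ 2 * k -> m = r ^+ 2 * l -> k = l.
  by move=> r0 -> /mulfI; apply; rewrite expf_neq0// gt_eqF.
apply/eqP; rewrite -subr_eq0 -normr_le0.
apply/ler_addgt0Pl => e e0; rewrite addr0.
have nU : nbhs x U by exact: open_nbhs_nbhs.
have c1 : {for x, continuous ('D_v ('D_u f))} by exact: ((cf.2 u).2 v).
have c2 : {for x, continuous ('D_u ('D_v f))} by exact: ((cf.2 v).2 u).
have e20 : 0 < e / 2 by exact: divr_gt0.
have n1 := near_dist c1 e20; have n2 := near_dist c2 e20.
have [r r0 hr] := near_plane u v (filterI nU (filterI n1 n2)).
have [a [b [ha hb E1]]] :=
  second_difference oU cf r0 (fun a b ha hb => (hr a b ha hb).1).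
have hU' c d : 0 <= c <= r -> 0 <= d <= r -> U (x + c *: v + d *: u).
  by move=> hc hd; have [] := hr d c hd hc; rewrite addrAC.
have [a' [b' [ha' hb' E2]]] := second_difference oU cf r0 hU'.
have [_ [k1 _]] := hr a b ha hb; have [_ [_ k2]] := hr b' a' hb' ha'.
rewrite (addrAC x (b' *: u)) in k2; rewrite (addrAC x (r *: v)) in E2.
have E := cancel _ _ _ _ r0 E1 (etrans (diff_swap _ _ _ _) E2).
exact: (close _ _ _ _ _ E k1 k2).
Qed.

(** * The inverse function theorem *)

Definition jac n m (y : 'rV[R]_n -> 'rV[R]_m) (x : 'rV[R]_n) : 'M[R]_(n, m) :=
  \matrix_(i, j) 'D_(delta_mx 0 i) (fun x => y x 0 j : R) x.

(** Rows of [jac] are indexed by directions, so differentials act on row vectors from the right;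
    [D0] uses the same convention, and the matrices of a composite multiply in the order in which
    the maps are applied. *)
Lemma derive_jac n m (y : 'rV[R]_n -> 'rV[R]_m) (x v : 'rV[R]_n) :
  differentiable y x -> 'D_v y x = v *m jac y x.
Proof.
move=> dy; apply/rowP => j.
rewrite derive_row// (derive_partials v ((differentiable_row y x).1 dy j)).
by rewrite mxE; apply: eq_bigr => i _; rewrite mxE.
Qed.

Lemma continuous_mulmxr n m (B : 'M[R]_(n, m)) :
  continuous (fun v : 'rV[R]_n => v *m B).
Proof.
move=> x; apply/continuous_row => j.
have h : Ck 0 setT (fun v : 'rV[R]_n => (v *m B) 0 j : R).
  apply: (@Ck_eq _ _ _ _ _ (fun v : 'rV[R]_n => \sum_i v 0 i * B i j)).
  - exact: openT.
  - by move=> v _; rewrite mxE.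
  apply: Ck_sum; first exact: openT.
  move=> i _; apply: CkM; [exact: openT|exact: Ck_coord|exact: Ck_cst].
exact: h.
Qed.

Lemma is_diff_mulmxr n m (B : 'M[R]_(n, m)) (x : 'rV[R]_n) :
  is_diff x (fun v : 'rV[R]_n => v *m B) (fun v : 'rV[R]_n => v *m B).
Proof.
have cB : continuous (mulmxr B : 'rV[R]_n -> 'rV[R]_m).
  exact: continuous_mulmxr.
apply: DiffDef; last exact: (diff_lin x cB).
by have /linear_differentiable := cB; apply.
Qed.

Lemma continuous_sub (T : topologicalType) V (f : T -> V) (a : V) (x : T) :
  {for x, continuous f} -> {for x, continuous (fun z => f z - a)}.
Proof. by move=> cf; apply: cvgB => //; exact: cvg_cst. Qed.

Lemma continuous_normr (T : topologicalType) V (f : T -> V) (x : T) :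
  {for x, continuous f} -> {for x, continuous (fun z => `|f z|)}.
Proof. by move=> cf; exact: cvg_norm cf. Qed.

Lemma differentiable_mulmxr V n m (f : V -> 'rV[R]_n) (B : 'M[R]_(n, m)) x :
  differentiable f x -> differentiable (fun z => f z *m B) x.
Proof.
move=> df; have [dB _] := is_diff_mulmxr B (f x).
exact: (differentiable_comp df dB).
Qed.

Lemma derive_mulmxr V n m (f : V -> 'rV[R]_n) (B : 'M[R]_(n, m)) x v :
  differentiable f x -> 'D_v (fun z => f z *m B) x = 'D_v f x *m B.
Proof.
move=> df; have [dB dBE] := is_diff_mulmxr B (f x).
by rewrite (derive_chain v df dB) (deriveE _ dB) dBE.
Qed.

Lemma continuous_affine (T : topologicalType) n m (f : T -> 'rV[R]_n)
    (a : 'rV[R]_n) (B : 'M[R]_(n, m)) (x : T) :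
  {for x, continuous f} -> {for x, continuous (fun z => (f z - a) *m B)}.
Proof.
move=> cf.
exact: (continuous_comp (continuous_sub cf) (@continuous_mulmxr _ _ B _)).
Qed.

Lemma mulmx_bound n m (B : 'M[R]_(n, m)) :
  exists2 k, 0 < k & forall v : 'rV[R]_n, `|v *m B| <= k * `|v|.
Proof. exact: (linear_lipschitz (f := mulmxr B) (@continuous_mulmxr _ _ B)). Qed.

Lemma Ck_jac n m (U : set 'rV[R]_n) (y : 'rV[R]_n -> 'rV[R]_m) i j :
  open U -> smooth_on U y -> smooth_on U (fun x => jac y x i j : R).
Proof.
move=> oU sy k; have /(Ck_row _ _ oU)/(_ j) [_ /(_ (delta_mx 0 i))] := sy k.+1.
by apply: Ck_eq => // x _; rewrite mxE.
Qed.

Lemma smooth_differentiable V W (U : set V) (f : V -> W) x :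
  smooth_on U f -> U x -> differentiable f x.
Proof. by move=> /(_ 1%N)[df _]; exact: df. Qed.

Lemma smooth_continuous V W (U : set V) (f : V -> W) x :
  smooth_on U f -> U x -> {for x, continuous f}.
Proof. by move=> /(_ 0%N) cf; exact: cf. Qed.

Lemma differentiable_boundE V W (f : V -> W) (x : V) : differentiable f x ->
  forall e, 0 < e -> \forall h \near (0 : V),
     `|f (h + x) - f x - 'd f x h| <= e * `|h|.
Proof.
move=> /diff_locally/eqaddoP df e e0; apply: filterS (df e e0) => h.
by rewrite !fctE /= opprD addrA.
Qed.

Lemma open_norm_lt (T : topologicalType) V (f : T -> V) (c : R) :
  continuous f -> open [set x | `|f x| < c].
Proof.
move=> cf; have := @open_comp _ _ (fun x => `|f x|) [set t : R | t < c].
apply; last exact: open_lt.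
move=> x _; exact: (cvg_norm (cf x)).
Qed.

(** With B the inverse Jacobian at [x0], the map x - y(x) B has Jacobian 1 - jac(x) B, which
    vanishes at [x0]. The mean value theorem in each coordinate then makes it contract by the factor
    1/2 near [x0]. *)
Lemma contraction_of_jac n (U : set 'rV[R]_n) (y : 'rV[R]_n -> 'rV[R]_n) x0 :
  open U -> U x0 -> smooth_on U y -> \det (jac y x0) != 0 ->
  exists2 r : R, 0 < r & forall x, `|x - x0| < r ->
   [/\ U x, \det (jac y x) != 0 & forall x', `|x' - x0| < r ->
   `|(x - x') - (y x - y x') *m invmx (jac y x0)| <= 2^-1 * `|x - x'|].
Proof.
move=> oU Ux0 sy det0; set B := invmx _.
have uA : jac y x0 \in unitmx by rewrite unitmxE unitfE.
pose phi x := x - y x *m B.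
pose M x := 1%:M - jac y x *m B.
have cj i j : smooth_on U (fun x => jac y x i j : R) by exact: Ck_jac.
have cM i j : {for x0, continuous (fun x => M x i j : R)}.
  have h : Ck 0 U (fun x => M x i j : R).
    apply: (@Ck_eq _ _ _ _ _ (fun x => (1%:M : 'M[R]_n) i j +
       - (\sum_k jac y x i k * B k j))) => //.
      by move=> x _; rewrite !mxE.
    apply: CkD => //; first exact: Ck_cst.
    apply: CkN => //; apply: Ck_sum => // k _; apply: CkM => //.
      exact: cj.
    exact: Ck_cst.
  exact: h.
have M0 : M x0 = 0 by rewrite /M mulmxV// subrr.
(* A column of [M x] has [n] entries, each below 1 / (2 (n + 1)), so their absolute values sum to at
   most 1/2; [n.+1] avoids a zero denominator when [n] is 0. *)
have c0 : 0 < (2 * n.+1%:R)^-1 :> R by rewrite invr_gt0 mulr_gt0.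
have nM : \forall x \near x0, forall ij : 'I_n * 'I_n,
    `|M x ij.1 ij.2| < (2 * n.+1%:R)^-1.
  apply: near_forall => -[i j] /=.
  have := near_dist (cM i j) c0.
  by apply: filterS => x; rewrite M0 mxE sub0r normrN.
have ndet : \forall x \near x0, \det (jac y x) != 0.
  have cd : {for x0, continuous (fun x => \det (jac y x) : R)}.
    have h : Ck 0 U (fun x => \det (jac y x) : R).
      by apply: Ck_det => // i j; exact: cj.
    exact: h.
  have d0 : 0 < `|\det (jac y x0)| by rewrite normr_gt0.
  have := near_dist cd d0; apply: filterS => x; apply: contraTneq => ->.
  by rewrite subr0 ltxx.
have nU : nbhs x0 U by exact: open_nbhs_nbhs.
have [r r0 rP] := (near_normP _ _).1 (filterI nU (filterI nM ndet)).
have {}rP x : `|x - x0| < r -> [/\ U x, \det (jac y x) != 0 &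
    forall ij : 'I_n * 'I_n, `|M x ij.1 ij.2| < (2 * n.+1%:R)^-1].
  by move=> /rP[? []].
exists r => // x xr; have [Ux dx _] := rP _ xr; split => // x' xr'.
have -> : x - x' - (y x - y x') *m B = phi x - phi x'.
  by rewrite /phi mulmxBl opprD addrACA -opprD.
apply: row_norm_le => [|j]; first by rewrite mulr_ge0.
have seg t : 0 <= t <= 1 -> `|x' + t *: (x - x') - x0| < r.
  move=> /andP[t0 t1].
  have -> : x' + t *: (x - x') - x0 = (1 - t) *: (x' - x0) + t *: (x - x0).
    apply/rowP => i; rewrite !mxE; ring.
  apply: le_lt_trans (ler_normD _ _) _.
  rewrite !normrZ !ger0_norm ?subr_ge0//.
  have [->|t0'] := eqVneq t 0; first by rewrite subr0 mul1r mul0r addr0.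
  have tp : 0 < t by rewrite lt_neqAle eq_sym t0'.
  have -> : r = (1 - t) * r + t * r by rewrite -mulrDl subrK mul1r.
  by rewrite ler_ltD ?ltr_pM2l// ler_wpM2l ?subr_ge0// ltW.
have dphi z : U z -> differentiable phi z.
  move=> Uz; apply: differentiableB; first by apply: ex_diff.
  exact: (differentiable_mulmxr B (smooth_differentiable sy Uz)).
have Dphi z v : U z -> 'D_v phi z = v *m M z.
  move=> Uz; have dy := smooth_differentiable sy Uz.
  have dyB := differentiable_mulmxr B dy.
  rewrite deriveB//; last exact: diff_derivable.
  rewrite derive_id derive_mulmxr// derive_jac// /M mulmxBr mulmx1.
  by rewrite mulmxA.
have dphij t : 0 <= t <= 1 ->
    differentiable (fun x => phi x 0 j : R) (x' + t *: (x - x')).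
  move=> /seg/rP[Uz _ _]; move: (dphi _ Uz) j; exact: (differentiable_row _ _).1.
have [t /seg/rP[Uz _ Mz]] := mean_value dphij.
rewrite [x' + (x - x')]addrC subrK => E; rewrite mxE [X in _ + X]mxE E.
rewrite -derive_row; last exact: dphi.
rewrite Dphi// mxE.
apply: le_trans (ler_norm_sum _ _ _) _.
apply: (@le_trans _ _ (\sum_(i < n) (2 * n.+1%:R)^-1 * `|x - x'|)).
  apply: ler_sum => i _; rewrite normrM mulrC; apply: ler_pM => //.
    exact/ltW/(Mz (i, j)).
  exact: coord_le_norm.
rewrite sumr_const card_ord -[X in X <= _]mulr_natl mulrA ler_wpM2r//.
rewrite invfM mulrCA ger_pMr ?invr_gt0//.
by rewrite ler_pdivrMr ?mul1r ?ler_nat.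
Qed.

Section Local.
Variables (n : nat) (y : 'rV[R]_n -> 'rV[R]_n) (x0 : 'rV[R]_n) (r : R).
Variable B : 'M[R]_n.
Hypothesis r0 : 0 < r.
Hypothesis uB : B \in unitmx.
Hypothesis cy : forall x, `|x - x0| < r -> {for x, continuous y}.
Hypothesis hy : forall x x', `|x - x0| < r -> `|x' - x0| < r ->
   `|(x - x') - (y x - y x') *m B| <= 2^-1 * `|x - x'|.

(** The triangle inequality absorbs half of the distance. The bound serves both for injectivity of
    [y] and for the Lipschitz estimate of its inverse. *)
Lemma dist_le_image x x' : `|x - x0| < r -> `|x' - x0| < r ->
  `|x - x'| <= 2 * `|(y x - y x') *m B|.
Proof.
move=> xr xr'; have := hy xr xr'; set d := _ *m B; set z := x - x' => H.
have : `|z| <= 2^-1 * `|z| + `|d|.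
  rewrite -[in leLHS](subrK d z) (le_trans (ler_normD _ _))//.
  by rewrite lerD2r.
by rewrite -lerBlDl -[X in X - _]mul1r -mulrBl; lra.
Qed.

(** A solution of y(x) = b is a fixed point of [T]. Instead of iterating, the displacement |T x - x|
    is minimised over a compact ball: as [T] halves distances, the displacement at [T c] is at most
    half of that at the minimiser [c], so the minimum is 0. The ball of radius r / 2 is stable,
    since (1/2)(r / 2) + r / 4 = r / 2. *)
Lemma local_preimage b : `|(b - y x0) *m B| < r / 4 ->
  exists2 x, `|x - x0| < r & y x = b.
Proof.
move=> bW; pose K := [set x : 'rV[R]_n | `|x - x0| <= r / 2].
have rr : r / 2 < r by rewrite ltr_pdivrMr// ltr_pMr// ltr1n.
have Kr x : K x -> `|x - x0| < r by move=> h; apply: le_lt_trans rr.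
have x00 : `|x0 - x0| < r by rewrite subrr normr0.
pose T x := x - (y x - b) *m B.
have TT x x' : T x - T x' = (x - x') - (y x - y x') *m B.
  rewrite /T !mulmxBl; apply/rowP => j; rewrite !mxE; ring.
have KT x : K x -> K (T x).
  move=> Kx; rewrite /K /=.
  have -> : T x - x0 = (T x - T x0) + (b - y x0) *m B.
    by rewrite /T !mulmxBl; apply/rowP => j; rewrite !mxE; ring.
  apply: le_trans (ler_normD _ _) _; rewrite TT.
  have := hy (Kr _ Kx) x00; have : `|x - x0| <= r / 2 by [].
  lra.
have Kx0 : K x0 by rewrite /K /= subrr normr0; lra.
have Kc : compact K.
  have KE : K = closed_ball x0 (r / 2).
    rewrite closed_ballE; last by lra.
    by apply/seteqP; split => x; rewrite /K /closed_ball_ /= distrC.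
  apply: bounded_closed_compact; last by rewrite KE; exact: closed_ball_closed.
  exists (r + `|x0|); split=> [|t rt x /Kr/ltW xr /=]; first exact: num_real.
  apply: le_trans (ltW rt).
  by rewrite -[x](subrK x0) (le_trans (ler_normD _ _))// lerD2r.
have Tc : {within K, continuous (fun x => `|T x - x|)}.
  apply: continuous_in_subspaceT => x; rewrite inE => Kx.
  have -> : (fun x => `|T x - x|) = (fun x => `|(y x - b) *m B|).
    by apply/funext => z; rewrite /T addrC addKr normrN.
  have h := @continuous_affine _ _ _ y b B x (cy (Kr _ Kx)).
  exact: (continuous_normr h).
have [c cK cmin] := EVT_min_rV (ex_intro _ x0 Kx0) Kc Tc.
rewrite inE in cK.
have TcK := KT _ cK.
have := cmin (T c); rewrite inE => /(_ TcK) H.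
have H2 : `|T (T c) - T c| <= 2^-1 * `|T c - c|.
  by rewrite TT; apply: hy; exact: Kr.
have T0 : `|T c - c| = 0.
  apply/eqP; rewrite eq_le normr_ge0 andbT.
  have := normr_ge0 (T c - c); lra.
exists c; first exact: Kr.
move/normr0_eq0: T0; rewrite /T addrC addKr => /eqP.
rewrite oppr_eq0 => /eqP cB; apply/subr0_eq.
by rewrite -[LHS]mulmx1 -(mulmxV uB) mulmxA cB mul0mx.
Qed.

End Local.

(** For w = g(b + h) - g(b), expanding [y] at [g b] gives h = w J + o(w). The Lipschitz bound turns
    o(w) into o(h), and multiplication by the inverse of J gives the expansion of [g]. *)
Lemma differentiable_inverse n (W : set 'rV[R]_n) (y g : 'rV[R]_n -> 'rV[R]_n)
    (k : R) (b : 'rV[R]_n) :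
  open W -> W b -> 0 < k -> (forall b', W b' -> y (g b') = b') ->
  (forall b', W b' -> `|g b' - g b| <= k * `|b' - b|) ->
  differentiable y (g b) -> jac y (g b) \in unitmx -> differentiable g b.
Proof.
move=> oW Wb k0 yg lip dy uJ.
have [C C0 hC] := mulmx_bound (invmx (jac y (g b))).
apply: (@differentiable_bound _ _ _ g (mulmxr (invmx (jac y (g b)))) b
  (@continuous_mulmxr _ _ _)) => e e0.
(* The factor [C] is lost in multiplying by the inverse Jacobian and [k] in passing from |w| to
   |h|. *)
have e'0 : 0 < e / (C * k) by rewrite divr_gt0// mulr_gt0.
have [s s0 hs] := (near_normP _ _).1 (differentiable_boundE dy e'0).
have [t t0 ht] := (near_normP _ _).1 (open_nbhs_nbhs (conj oW Wb)).
(* The bound [t] keeps [h + b] in [W]; the bound [s / k] keeps the increment of [g] below [s]. *)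
apply/near_normP; exists (Num.min t (s / k)).
  by rewrite lt_min t0 divr_gt0.
move=> h; rewrite subr0 lt_min => /andP[h1 h2].
have Wh : W (h + b) by apply: ht; rewrite addrK.
have lh : `|g (h + b) - g b| <= k * `|h| by rewrite -{2}(addrK b h); exact: lip.
have := hs (g (h + b) - g b); rewrite subr0 subrK !yg// addrK -deriveE//.
rewrite derive_jac// => /(_ _)H.
have {}H := H (le_lt_trans lh _).
have -> : g (h + b) - g b - mulmxr (invmx (jac y (g b))) h =
  - ((h - (g (h + b) - g b) *m jac y (g b)) *m invmx (jac y (g b))).
  by rewrite mulmxBl mulmxK// opprB.
rewrite normrN (le_trans (hC _))//.
have -> : e * `|h| = C * (e / (C * k) * (k * `|h|)).
  by field; rewrite !gt_eqF.
apply: ler_wpM2l; first exact: ltW.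
apply: le_trans (H _) _.
  by rewrite mulrC -ltr_pdivlMr.
by apply: ler_wpM2l => //; exact: ltW.
Qed.

Lemma derive_inverse n (W : set 'rV[R]_n) (y g : 'rV[R]_n -> 'rV[R]_n)
    (b v : 'rV[R]_n) :
  open W -> W b -> (forall b', W b' -> y (g b') = b') ->
  differentiable y (g b) -> differentiable g b -> jac y (g b) \in unitmx ->
  'D_v g b = v *m invmx (jac y (g b)).
Proof.
move=> oW Wb yg dy dg uJ.
have : 'D_v (y \o g) b = v.
  rewrite -[RHS](derive_id b v); apply: near_eq_derive.
  exact: (open_near oW Wb).
rewrite (derive_chain v dg dy) derive_jac// => E; rewrite -{2}E.
by rewrite (mulmxK uJ).
Qed.

(** Bootstrapping: D_v g = v J(g)^-1 is of class C^k as soon as [g] is, which makes [g] of class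
    C^(k+1). *)
Lemma smooth_inverse n (U W : set 'rV[R]_n) (y g : 'rV[R]_n -> 'rV[R]_n) :
  open U -> open W -> smooth_on U y -> (forall b, W b -> U (g b)) ->
  (forall b, W b -> y (g b) = b) -> (forall b, W b -> differentiable g b) ->
  (forall b, W b -> jac y (g b) \in unitmx) -> smooth_on W g.
Proof.
move=> oU oW sy gU yg dg uJ; elim=> [|k IH].
  by move=> b Wb; exact/differentiable_continuous/dg.
split=> // v.
apply: (@Ck_eq _ _ _ _ _ (fun b => v *m invmx (jac y (g b)))) => //.
  move=> b Wb; rewrite (derive_inverse (y := y) v oW Wb)//;
    first exact: smooth_differentiable sy (gU _ Wb).
    exact: dg.
  exact: uJ.
apply/(Ck_row _ _ oW) => j.
apply: (@Ck_eq _ _ _ _ _ (fun b => \sum_i v 0 i * invmx (jac y (g b)) i j)) => //.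
  by move=> b _; rewrite mxE.
apply: Ck_sum => // i _; apply: CkM => //; first exact: Ck_cst.
move: i j; apply: Ck_invmx => // [b Wb|i j].
  by rewrite -unitfE -unitmxE; exact: uJ.
exact: (Ck_comp_scalar oW gU IH (Ck_jac i j oU sy k)).
Qed.

Theorem inverse_function n (U : set 'rV[R]_n) (y : 'rV[R]_n -> 'rV[R]_n) x0 :
  open U -> U x0 -> smooth_on U y -> \det (jac y x0) != 0 ->
  exists (V W : set 'rV[R]_n) (g : 'rV[R]_n -> 'rV[R]_n),
    [/\ open V, V x0, V `<=` U, open W & smooth_on W g] /\
    (forall x, V x -> W (y x) /\ g (y x) = x) /\
    (forall b, W b -> V (g b) /\ y (g b) = b).
Proof.
move=> oU Ux0 sy det0.
have [r r0 hr] := contraction_of_jac oU Ux0 sy det0.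
set B := invmx _ in hr.
have uB : B \in unitmx by rewrite unitmx_inv unitmxE unitfE.
have Ur x : `|x - x0| < r -> U x by move=> /hr[].
have cy x : `|x - x0| < r -> {for x, continuous y}.
  by move=> /Ur; exact: smooth_continuous.
have hy x x' : `|x - x0| < r -> `|x' - x0| < r ->
   `|(x - x') - (y x - y x') *m B| <= 2^-1 * `|x - x'|.
  by move=> /hr[_ _]; apply.
have inj x x' : `|x - x0| < r -> `|x' - x0| < r -> y x = y x' -> x = x'.
  move=> xr xr' E; apply/subr0_eq/eqP; rewrite -normr_le0.
  by have := dist_le_image hy xr xr'; rewrite E subrr mul0mx normr0 mulr0.
(* [W] consists of the values covered by [local_preimage]. Cutting the ball down to the preimage of
   [W] makes [y] and [g] mutually inverse between [V] and [W]. *)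
pose W := [set b | `|(b - y x0) *m B| < r / 4].
pose V := [set x | `|x - x0| < r] `&` [set x | W (y x)].
pose g b := xget x0 [set x | `|x - x0| < r /\ y x = b].
have gP b : W b -> `|g b - x0| < r /\ y (g b) = b.
  move=> Wb; rewrite /g; case: xgetP => // H.
  by have [x xr yx] := local_preimage r0 uB cy hy Wb; case: (H x).
have oW : open W.
  apply: open_norm_lt => b; apply: (@continuous_affine _ _ _ id).
  exact: cvg_id.
have oball : open [set x : 'rV[R]_n | `|x - x0| < r].
  apply: (@open_norm_lt _ _ (fun x : 'rV[R]_n => x - x0)) => b.
  by apply: (@continuous_sub _ _ id); exact: cvg_id.
have oV : open V.
  rewrite openE => x [xr Wx]; apply: filterI; first exact: open_nbhs_nbhs.
  by apply: (cy x xr); exact: open_nbhs_nbhs.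
have [C C0 hC] := mulmx_bound B.
have uJ b : W b -> jac y (g b) \in unitmx.
  by move=> /gP[/hr[_ + _] _]; rewrite unitmxE unitfE.
have dg b : W b -> differentiable g b.
  move=> Wb; have [gr ygb] := gP _ Wb.
  apply: (@differentiable_inverse _ W y g (2 * C)) => //.
  - exact: mulr_gt0.
  - by move=> b' /gP[].
  - move=> b' /gP[gr' ygb']; apply: le_trans (dist_le_image hy gr' gr) _.
    by rewrite ygb ygb' -mulrA ler_wpM2l.
  - exact: smooth_differentiable sy (Ur _ gr).
  - exact: uJ.
exists V, W, g; split; first split => //.
- by split; rewrite /= /W /= ?subrr ?mul0mx normr0//; lra.
- by move=> x [/Ur].
- apply: smooth_inverse oU oW sy _ _ dg uJ => b /gP[]//.
  by move=> /Ur.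
split=> [x [xr Wx]|b Wb].
  by split=> //; have [gr ygx] := gP _ Wx; exact: inj.
by have [gr ygb] := gP _ Wb; split => //; split => //=; rewrite ygb.
Qed.

End InverseFunction.

(** * Jets and differential functions *)

Section Jets.
Variables (R : realType) (p : nat).
Local Notation ee i := (delta_mx (0 : 'I_1) i).

Section PartialDerivatives.
Variable q : nat.
Implicit Types (f g : 'rV[R]_p -> 'rV[R]_q) (U : set 'rV[R]_p) (J : midx p).

Lemma smooth_derive (V W : normedModType R) (U : set V) (f : V -> W) v :
  smooth_on U f -> smooth_on U (fun x => 'D_v f x).
Proof. by move=> sf k; exact: (sf k.+1).2. Qed.

Lemma smooth_eq (V W : normedModType R) (U : set V) (f g : V -> W) :
  open U -> (forall x, U x -> f x = g x) -> smooth_on U f -> smooth_on U g.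
Proof. by move=> oU fg sf k; exact: Ck_eq (sf k). Qed.

Lemma derive_comm_row U f x (u v : 'rV[R]_p) :
  open U -> U x -> smooth_on U f -> 'D_v ('D_u f) x = 'D_u ('D_v f) x.
Proof.
move=> oU Ux sf; apply/rowP => j.
have sd w y : U y -> 'D_w f y 0 j = 'D_w (fun y => f y 0 j : R) y.
  by move=> Uy; apply: derive_row; exact: smooth_differentiable sf Uy.
have dd w y : U y -> differentiable ('D_w f) y.
  by move=> Uy; exact: (smooth_differentiable (smooth_derive w sf) Uy).
have mixed w w' : 'D_w ('D_w' f) x 0 j = 'D_w ('D_w' (fun y => f y 0 j : R)) x.
  exact: etrans (derive_row w j (dd w' x Ux))
                (near_eq_derive w (open_near oU Ux (sd w'))).
have cf : Ck 2 U (fun y => f y 0 j : R).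
  by have /(Ck_row _ _ oU)/(_ j) := sf 2.
exact: etrans (mixed v u) (etrans (derive_comm u v oU Ux cf) (esym (mixed u v))).
Qed.

Lemma derive_eq_on (V W : normedModType R) (U : set V) (f g : V -> W) v x :
  open U -> (forall x, U x -> f x = g x) -> U x -> 'D_v f x = 'D_v g x.
Proof. by move=> oU fg Ux; apply: near_eq_derive; exact: open_near oU Ux fg. Qed.

Lemma iter_derive_eq U f g v n x :
  open U -> (forall x, U x -> f x = g x) -> U x ->
  iter n (fun h x => 'D_v h x) f x = iter n (fun h x => 'D_v h x) g x.
Proof.
move=> oU fg; elim: n x => [|n IH] x Ux; first exact: fg.
by rewrite !iterS; apply: (derive_eq_on _ oU IH Ux).
Qed.

Lemma smooth_iter_derive U f v n :
  smooth_on U f -> smooth_on U (iter n (fun h x => 'D_v h x) f).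
Proof. by move=> sf; elim: n => // n IH; rewrite iterS; exact: smooth_derive. Qed.

Lemma iter_derive_comm U f u v n x :
  open U -> smooth_on U f -> U x ->
  iter n (fun h x => 'D_v h x) ('D_u f) x =
  'D_u (iter n (fun h x => 'D_v h x) f) x.
Proof.
move=> oU sf; elim: n x => [//|n IH] x Ux.
rewrite !iterS (derive_eq_on v oU IH Ux).
exact: (derive_comm_row u v oU Ux (smooth_iter_derive v n sf)).
Qed.

(** This is [pderiv] along an arbitrary list of directions in place of [enum 'I_p], so that
    induction on the list is possible. *)
Let pd (r : seq 'I_p) J f := foldr (fun i h =>
  iter (J i) (fun h' x => 'D_(ee i) h' x) h) f r.

Let smooth_pd r J U f : smooth_on U f -> smooth_on U (pd r J f).
Proof. by move=> sf; elim: r => //= i r IH; exact: smooth_iter_derive. Qed.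

Let pd_notin r J f i : i \notin r -> pd r (midxS J i) f = pd r J f.
Proof.
elim: r => //= j r IH; rewrite inE negb_or => /andP[ij ir].
by rewrite (IH ir) ffunE eq_sym (negbTE ij) addn0.
Qed.

(** If [i] heads the list, the extra derivative is already outermost and, by [uniq], does not recur.
    Otherwise it is moved out past the derivatives in the head direction by Schwarz's theorem. *)
Let pdS r J U f i x : open U -> smooth_on U f -> uniq r -> i \in r -> U x ->
  pd r (midxS J i) f x = 'D_(ee i) (pd r J f) x.
Proof.
move=> oU sf; elim: r x => //= j r IH x /andP[jr ur].
rewrite inE => ijr Ux; have [ij|ij] := eqVneq i j.
  by rewrite -ij ffunE eqxx addn1 iterS pd_notin// ij.
have {}ijr : i \in r by move: ijr; rewrite (negbTE ij).
rewrite ffunE eq_sym (negbTE ij) addn0.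
rewrite (iter_derive_eq _ _ oU (fun x => IH x ur ijr) Ux).
exact: (iter_derive_comm _ _ _ oU (smooth_pd r J sf) Ux).
Qed.

Lemma smooth_pderiv U J f : smooth_on U f -> smooth_on U (pderiv J f).
Proof. exact: smooth_pd. Qed.

Lemma derive_pderiv U J f i x : open U -> smooth_on U f -> U x ->
  'D_(ee i) (pderiv J f) x = pderiv (midxS J i) f x.
Proof. by move=> oU sf Ux; rewrite -(pdS J oU sf) ?enum_uniq ?mem_enum. Qed.

Lemma pderiv0 f : pderiv (midx0 p) f = f.
Proof.
rewrite /pderiv; elim: (enum _) => //= i r IH.
by rewrite ffunE.
Qed.

Lemma jbase_graph f x : jbase (jet_graph f x) = row_mx x (f x).
Proof.
rewrite /jbase /= pderiv0; congr row_mx; by apply/rowP => j; rewrite mxE.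
Qed.

Lemma differentiable_jet_graph U f x A : open U -> smooth_on U f -> U x ->
  differentiable (fun y => jet_graph f y A : R) x.
Proof.
move=> oU sf Ux; case: A => [i|[al J]] /=.
  exact: differentiable_coord.
move: al; apply/differentiable_row.
exact: (smooth_differentiable (smooth_pderiv J sf) Ux).
Qed.

(** Prolonged graphs are tangent to the total derivative D_i. This is the bridge between
    [total_vector], which is formal, and actual differentiation. *)
Lemma derive_jet_graph U f x i A : open U -> smooth_on U f -> U x ->
  'D_(ee i) (fun y => jet_graph f y A : R) x =
  total_vector i (jet_graph f x) A.
Proof.
move=> oU sf Ux; case: A => [j|[al J]] /=.
  rewrite (@derive_val _ _ _ _ _ _ _ (is_derive_coord x (ee i) j)).
  by rewrite mxE eqxx.
rewrite -(derive_pderiv J i oU sf Ux) derive_row//.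
exact: (smooth_differentiable (smooth_pderiv J sf) Ux).
Qed.

End PartialDerivatives.

Lemma near_preimage (T T' : topologicalType) (f : T -> T') (U : set T') x :
  {for x, continuous f} -> open U -> U (f x) -> \forall y \near x, U (f y).
Proof. by move=> cf oU Ux; apply: cf; exact: open_nbhs_nbhs. Qed.

Lemma sum_midxS (J : midx p) i : (\sum_j midxS J i j)%N = (\sum_j J j).+1.
Proof.
rewrite (eq_bigr (fun j => J j + (j == i))%N); last by move=> j _; rewrite ffunE.
rewrite big_split /= -[RHS]addn1; congr (_ + _)%N.
by rewrite (bigD1 i)//= eqxx big1// => j /negbTE ->.
Qed.

(** * Functions of finite order on the jet space *)

Section DifferentialFunctions.
Variable q : nat.
Implicit Types (z : jet R p q) (k : nat) (A : jidx p q).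

Lemma jidxk_val_order k (B : jidxk p q k) : (jorder (jidxk_val B) <= k)%N.
Proof.
case: B => [i|[al [J HJ]]] //=; apply: leq_trans HJ.
by apply: eq_leq; apply: eq_bigr => i _; rewrite ffunE.
Qed.

Lemma jidxk_val_inj k : injective (@jidxk_val p q k).
Proof.
move=> [i|[al J]] [i'|[al' J']] //= [].
  by move=> ->.
move=> -> /ffunP JJ; congr (inr (_, _)); apply: val_inj; apply/ffunP => i.
by apply: val_inj; have := JJ i; rewrite !ffunE.
Qed.

Lemma jidxk_val_onto k A : (jorder A <= k)%N -> exists B : jidxk p q k, jidxk_val B = A.
Proof.
case: A => [i|[al J]] /= Jk; first by exists (inl i).
have Ji i : (J i < k.+1)%N by rewrite ltnS (leq_trans _ Jk)// (bigD1 i)//= leq_addr.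
pose J' : {ffun 'I_p -> 'I_k.+1} := [ffun i => Ordinal (Ji i)].
have HJ' : (\sum_i (J' i : nat) <= k)%N.
  by apply: leq_trans Jk; apply: eq_leq; apply: eq_bigr => i _; rewrite ffunE.
exists (inr (al, exist _ J' HJ')) => /=; congr (inr (_, _)).
by apply/ffunP => i; rewrite !ffunE.
Qed.

(* A section of [jtrunc k]: the coordinates of order greater than [k] are 0. *)
Definition jext k (v : 'rV[R]_#|jidxk p q k|) : jet R p q := fun A =>
  if [pick B | jidxk_val B == A] is Some B then v 0 (enum_rank B) else 0.

Definition agree k z z' := forall A, (jorder A <= k)%N -> z A = z' A.

Lemma jext_trunc k z : agree k (jext (jtrunc k z)) z.
Proof.
move=> A /jidxk_val_onto[B BA]; rewrite /jext; case: pickP => [B' /eqP E|/(_ B)].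
  by rewrite mxE enum_rankK E.
by rewrite BA eqxx.
Qed.

Lemma jtrunc_ext k (v : 'rV[R]_#|jidxk p q k|) : jtrunc k (jext v) = v.
Proof.
apply/rowP => i; rewrite mxE /jext; case: pickP => [B /eqP/jidxk_val_inj ->|].
  by rewrite enum_valK.
by move/(_ (enum_val i)); rewrite eqxx.
Qed.

Lemma agree_trunc k z z' : agree k z z' <-> jtrunc k z = jtrunc k z'.
Proof.
split=> [zz'|E A Ak]; last by rewrite -(jext_trunc z Ak) E jext_trunc.
by apply/rowP => i; rewrite !mxE; apply: zz'; exact: jidxk_val_order.
Qed.

Lemma agree_sym k z z' : agree k z z' -> agree k z' z.
Proof. by move=> zz' A Ak; rewrite zz'. Qed.

Lemma agreeW k k' z z' : (k <= k')%N -> agree k' z z' -> agree k z z'.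
Proof. by move=> kk' zz' A Ak; apply: zz'; exact: leq_trans kk'. Qed.

Lemma Ck_jext k n (U : set 'rV[R]_#|jidxk p q k|) A :
  Ck n U (fun v => jext v A).
Proof.
rewrite /jext; case: pickP => [B _|_]; first exact: Ck_coord.
exact: (Ck_cst n U (0 : R)).
Qed.

(* Up to the condition on the domain [jets_over], [cylinder k E] and
   [dfun k E F] together amount to [differential_function_of_order c k E F]:
   the set [U] and the function [f] on truncated jets are read off along the
   section [jext k]. *)
Definition cylinder k (E : set (jet R p q)) :=
  (forall z z', agree k z z' -> E z -> E z') /\ open (@jext k @^-1` E).

Definition dfun k (E : set (jet R p q)) (F : jet R p q -> R) :=
  smooth_on (@jext k @^-1` E) (F \o @jext k) /\
  (forall z z', agree k z z' -> E z -> F z = F z').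

(** Since [jtrunc k] is a left inverse of [jext k], the open set of truncated jets must be the
    preimage of [E] under [jext k], and on it the function must be [F \o @jext k]. *)
Lemma dfunP (M : manifold R (p + q)) (c : chart R (p + q) M) k E F :
  differential_function_of_order c k E F <->
  [/\ E `<=` jets_over c, cylinder k E & dfun k E F].
Proof.
split=> [[EM [U [f [oU EU sf Ff]]]]|[EM [aE oE] [sF aF]]].
  have pE : @jext k @^-1` E = U.
    by apply/seteqP; split=> v; rewrite /preimage /= EU /= jtrunc_ext.
  split=> //; first split; rewrite ?pE//.
    by move=> z z' /agree_trunc zz'; rewrite EU /preimage /= zz'.
  split; rewrite ?pE.
    apply: smooth_eq sf => // v Uv /=; rewrite Ff ?jtrunc_ext//.
    by rewrite EU /preimage /= jtrunc_ext.
  move=> z z' zz' Ez; rewrite !Ff//; first by congr f; exact/agree_trunc.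
  by move: Ez; rewrite EU /preimage /= ((agree_trunc _ _ _).1 zz').
split=> //; exists (@jext k @^-1` E), (F \o @jext k); split => //.
  apply/seteqP; split=> z; rewrite /preimage /=; apply: aE.
    exact/agree_sym/jext_trunc.
  exact: jext_trunc.
move=> z Ez; apply: aF => //; exact/agree_sym/jext_trunc.
Qed.

Section Lift.
Variables (k k' : nat).
Hypothesis kk' : (k <= k')%N.

(** The projection from J^k' to J^k in truncated coordinates. *)
Let tau (v : 'rV[R]_#|jidxk p q k'|) : 'rV[R]_#|jidxk p q k| :=
  jtrunc k (jext v).

Let Ck_tau n U : open U -> Ck n U tau.
Proof.
move=> oU; apply/Ck_row => // j.
apply: Ck_eq (Ck_jext n U (jidxk_val (enum_val j))) => // v _.
by rewrite mxE.
Qed.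

Lemma cylinder_lift E : cylinder k E -> cylinder k' E.
Proof.
move=> [aE oE]; split=> [z z' /(agreeW kk')|]; first exact: aE.
have -> : @jext k' @^-1` E = tau @^-1` (@jext k @^-1` E).
  apply/seteqP; split=> v; apply: aE; last exact: jext_trunc.
  exact/agree_sym/jext_trunc.
apply: open_comp oE => v _.
by have := @Ck_tau 0 setT openT; apply.
Qed.

Lemma dfun_lift E F : cylinder k E -> dfun k E F -> dfun k' E F.
Proof.
move=> cE [sF aF]; have oE := (cylinder_lift cE).2.
split=> [n|z z' /(agreeW kk')]; last exact: aF.
have tE v : E (jext v) -> E (jext (tau v)).
  by apply: cE.1; exact/agree_sym/jext_trunc.
apply: Ck_eq (Ck_comp_scalar oE tE (Ck_tau n oE) (sF n)) => // v Ev /=.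
by apply: aF; [exact: jext_trunc|exact: tE].
Qed.

End Lift.

Lemma dfun_eq k E F F' : cylinder k E -> (forall z, E z -> F z = F' z) ->
  dfun k E F -> dfun k E F'.
Proof.
move=> [aE oE] FF' [sF aF]; split.
  by apply: smooth_eq sF => // v /FF'.
by move=> z z' zz' Ez; rewrite -!FF'//; [exact: aF|exact: aE zz' Ez].
Qed.

Lemma dfun_sub k E E' F : E' `<=` E -> dfun k E F -> dfun k E' F.
Proof.
move=> EE' [sF aF]; split=> [n|z z' zz' /EE']; last exact: aF.
by apply: Ck_sub (sF n) => v /EE'.
Qed.

Lemma dfun_coord k E A : (jorder A <= k)%N -> dfun k E (fun z => z A).
Proof.
move=> Ak; split=> [n|z z' zz' _]; last exact: zz'.
exact: Ck_jext.
Qed.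

Lemma dfun_cst k E a : dfun k E (fun=> a).
Proof. by split=> // n; exact: Ck_cst. Qed.

Lemma dfunM k E F F' : cylinder k E -> dfun k E F -> dfun k E F' ->
  dfun k E (fun z => F z * F' z).
Proof.
move=> [_ oE] [sF aF] [sF' aF']; split.
  by move=> n; exact: (CkM oE (sF n) (sF' n)).
by move=> z z' zz' Ez; rewrite (aF _ _ zz' Ez) (aF' _ _ zz' Ez).
Qed.

Lemma dfunD k E F F' : cylinder k E -> dfun k E F -> dfun k E F' ->
  dfun k E (fun z => F z + F' z).
Proof.
move=> [_ oE] [sF aF] [sF' aF']; split.
  by move=> n; exact: (CkD oE (sF n) (sF' n)).
by move=> z z' zz' Ez; rewrite (aF _ _ zz' Ez) (aF' _ _ zz' Ez).
Qed.

Lemma dfun_sum k E (I : finType) (F : I -> jet R p q -> R) : cylinder k E ->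
  (forall i, dfun k E (F i)) -> dfun k E (fun z => \sum_i F i z).
Proof.
move=> [_ oE] dF; split.
  move=> n; apply: Ck_eq (Ck_sum (index_enum I) (P := xpredT) oE (fun i _ => (dF i).1 n)) => //.
by move=> z z' zz' Ez; apply: eq_bigr => i _; exact: (dF i).2.
Qed.

Lemma dfun_comp k E n (U : set 'rV[R]_n) (g : 'rV[R]_n -> R)
    (G : jet R p q -> 'rV[R]_n) :
  cylinder k E -> (forall j, dfun k E (fun z => G z 0 j)) ->
  (forall z, E z -> U (G z)) -> smooth_on U g -> dfun k E (fun z => g (G z)).
Proof.
move=> [aE oE] dG EU sg; split=> [m|z z' zz' Ez]; last first.
  by congr g; apply/rowP => j; exact: (dG j).2.
have cG : Ck m (@jext k @^-1` E) (G \o @jext k).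
  by apply/Ck_row => // j; exact: (dG j).1.
exact: (Ck_comp_scalar oE (fun v Ev => EU _ Ev) cG (sg m)).
Qed.

Lemma cylinder_preimage k E n (U : set 'rV[R]_n) (G : jet R p q -> 'rV[R]_n) :
  cylinder k E -> (forall j, dfun k E (fun z => G z 0 j)) -> open U ->
  cylinder k (E `&` G @^-1` U).
Proof.
move=> [aE oE] dG oU; split.
  move=> z z' zz' [Ez UGz]; split; first exact: aE zz' Ez.
  rewrite /preimage /= -(_ : G z = G z')//.
  by apply/rowP => j; exact: (dG j).2.
rewrite openE => v [Ev Uv]; apply: filterI; first exact: open_nbhs_nbhs.
have cG : {for v, continuous (G \o @jext k)}.
  by apply/continuous_row => j; exact: ((dG j).1 0%N).
by apply: cG; exact: open_nbhs_nbhs.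
Qed.

Lemma dfun_invmx k E n (B : jet R p q -> 'M[R]_n) : cylinder k E ->
  (forall i j, dfun k E (fun z => B z i j)) ->
  (forall z, E z -> \det (B z) != 0) ->
  forall i j, dfun k E (fun z => invmx (B z) i j).
Proof.
move=> [aE oE] dB B0 i j; split=> [m|z z' zz' Ez].
  by apply: (Ck_invmx oE) => [v Ev|a b]; [exact: B0|exact: (dB a b).1].
by congr (invmx _ i j); apply/matrixP => a b; exact: (dB a b).2.
Qed.

(** Reduces [dform], a derivative along a line in an infinite product, to a directional derivative
    in finite dimension; linearity in [X] and the chain rule become available. *)
Lemma dform_dfun k E F z X : cylinder k E -> dfun k E F -> E z ->
  dform F z X = 'D_(jtrunc k X) (F \o @jext k) (jtrunc k z).
Proof.
move=> [aE oE] [sF aF] Ez.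
have Ev : E (jext (jtrunc k z)) by apply: aE Ez; exact/agree_sym/jext_trunc.
have dF : differentiable (F \o @jext k) (jtrunc k z).
  exact: (smooth_differentiable sF Ev).
have dl : is_derive (0 : R) (1 : R)
    (fun t : R => (F \o @jext k) (jtrunc k z + t *: jtrunc k X))
    ('D_(jtrunc k X) (F \o @jext k) (jtrunc k z + 0 *: jtrunc k X)).
  by apply: is_derive_line; rewrite scale0r addr0.
rewrite /dform derive1E; move: dl; rewrite scale0r addr0 => dl.
rewrite -(@derive_val _ _ _ _ _ _ _ dl); apply: near_eq_derive.
(* Off [E] the values of [F] are arbitrary, so the two curves can be compared only while the
   truncated line stays in the open domain. *)
have nE : \forall t \near (0 : R), E (jext (jtrunc k z + t *: jtrunc k X)).
  have cl : {for (0 : R), continuous (fun t : R => jtrunc k z + t *: jtrunc k X)}.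
    apply: differentiable_continuous; apply: differentiableD.
      exact: differentiable_cst.
    exact: differentiableZl.
  have Ev0 : E (jext (jtrunc k z + (0 : R) *: jtrunc k X)).
    by rewrite scale0r addr0.
  exact: (near_preimage cl oE Ev0).
apply: filterS nE => t Et /=; apply/esym; apply: aF => //.
move=> A Ak; have [B <-] := jidxk_val_onto Ak.
by rewrite {1}/jext; case: pickP => [B' /eqP/jidxk_val_inj ->|/(_ B)];
  rewrite ?eqxx// !mxE enum_rankK.
Qed.

(** The chain rule for a family of jets that is differentiable only coordinate by coordinate;
    finitely many coordinates matter, so this is enough. *)
Lemma derive_dfun (V : normedModType R) k E F (gam : V -> jet R p q) (x v : V) :
  cylinder k E -> dfun k E F -> E (gam x) ->
  (forall A, differentiable (fun y => gam y A : R) x) ->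
  differentiable (fun y => F (gam y)) x /\
  'D_v (fun y => F (gam y)) x =
  dform F (gam x) (fun A => 'D_v (fun y => gam y A : R) x).
Proof.
move=> cE dF Ex dg; rewrite (dform_dfun _ cE dF Ex).
have [aE oE] := cE; have [sF aF] := dF.
have dt : differentiable (fun y => jtrunc k (gam y)) x.
  apply/differentiable_row => j.
  apply: differentiable_near_eq (dg (jidxk_val (enum_val j))).
  by apply: nearW => y; rewrite mxE.
have Ev : E (jext (jtrunc k (gam x))) by apply: aE Ex; exact/agree_sym/jext_trunc.
have dFe := smooth_differentiable sF Ev.
have nE : \forall y \near x, (F \o @jext k) (jtrunc k (gam y)) = F (gam y).
  have : \forall y \near x, E (jext (jtrunc k (gam y))).
    exact: (near_preimage (differentiable_continuous dt) oE Ev).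
  by apply: filterS => y Ey /=; apply: aF => //; exact: jext_trunc.
split.
  exact: differentiable_near_eq nE (differentiable_comp dt dFe).
rewrite -(near_eq_derive v nE) (derive_chain v dt dFe).
congr ('D_ _ _ _); apply/rowP => j; rewrite derive_row// mxE.
by apply: near_eq_derive; apply: nearW => y; rewrite mxE.
Qed.

Lemma total_vector_order k i z z' A : agree k.+1 z z' -> (jorder A <= k)%N ->
  total_vector i z A = total_vector i z' A.
Proof.
by move=> zz'; case: A => //= -[al J] Jk; apply: zz'; rewrite /= sum_midxS.
Qed.

(** The component of D_i along a coordinate of order at most [k] is a constant or a coordinate of
    order at most k + 1, hence the rise of the order by one. *)
Lemma dfun_total k E F i : cylinder k E -> dfun k E F ->
  dfun k.+1 E (fun z => dform F z (total_vector i z)).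
Proof.
move=> cE dF; have [aE oE] := cE; have [sF aF] := dF.
have cE' := cylinder_lift (leqnSn k) cE.
apply: (@dfun_eq _ _ (fun z => \sum_j (total_vector i z (jidxk_val (enum_val j))) *
   'D_(ee j) (F \o @jext k) (jtrunc k z))) => //.
  move=> z Ez; rewrite (dform_dfun _ cE dF Ez) derive_partials.
    by apply: eq_bigr => j _; rewrite mxE.
  apply: (smooth_differentiable sF).
  by apply: aE Ez; exact/agree_sym/jext_trunc.
apply: dfun_sum => // j; apply: dfunM => //.
  have := jidxk_val_order (enum_val j); case: (jidxk_val _) => [l|[al J]] Jk /=.
    exact: dfun_cst.
  split=> [n|z z' zz' _]; first exact: Ck_jext.
  exact: (@total_vector_order k i z z' (inr (al, J)) zz' Jk).
apply: (@dfun_comp _ _ _ (@jext k @^-1` E) ('D_(ee j) (F \o @jext k))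
  (@jtrunc R p q k) cE').
- move=> l; apply: (@dfun_eq _ _ (fun z => z (jidxk_val (enum_val l)))) => //.
    by move=> z _; rewrite mxE.
  by apply: dfun_coord; rewrite ltnW// ltnS jidxk_val_order.
- by move=> z; apply: aE; exact/agree_sym/jext_trunc.
- exact: smooth_derive.
Qed.

End DifferentialFunctions.
End Jets.

(** * Polynomials with a prescribed jet *)

Section Polynomials.
Variables (R : realType) (p : nat).
Local Notation ee i := (delta_mx (0 : 'I_1) i).

Lemma derive_constant_line (V W : normedModType R) (c : V -> W) (x v : V) :
  (forall t : R, c (t *: v + x) = c x) -> 'D_v c x = 0.
Proof.
move=> cx; rewrite /derive.
have -> : (fun h : R => h^-1 *: ((c \o shift x) (h *: v) - c x)) = cst 0.
  by apply/funext => h /=; rewrite cx subrr scaler0.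
exact: lim_cst.
Qed.

(* The [m]-th derivative of [t ^ n / n!]. *)
Definition taylor_factor (n m : nat) (t : R) : R :=
  if (m <= n)%N then ((n - m)`!%:R)^-1 * t ^+ (n - m) else 0.

(** The partial derivative of index [K] of (x - a)^J / J!. *)
Definition taylor_monomial (a : 'rV[R]_p) (J K : midx p) (x : 'rV[R]_p) : R :=
  \prod_i taylor_factor (J i) (K i) (x 0 i - a 0 i).

Lemma taylor_factor0 n m : taylor_factor n m 0 = (n == m)%:R.
Proof.
rewrite /taylor_factor; case: (ltngtP m n) => [mn|mn|->].
- by rewrite expr0n subn_eq0 leqNgt mn mulr0.
- by [].
- by rewrite subnn expr0 mulr1 invr1.
Qed.

Lemma taylor_monomial_center a J K : taylor_monomial a J K a = (J == K)%:R.
Proof.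
rewrite /taylor_monomial; have [->|JK] := eqVneq J K.
  by rewrite big1// => i _; rewrite subrr taylor_factor0 eqxx.
have [i Ji] : exists i, J i != K i.
  apply/existsP; rewrite -negb_forall; apply: contra JK => /forallP E.
  by apply/eqP/ffunP => i; exact/eqP.
by rewrite (bigD1 i)//= subrr taylor_factor0 (negbTE Ji) mul0r.
Qed.

Lemma smooth_taylor_factor (a : 'rV[R]_p) n m i U : open U ->
  smooth_on U (fun x : 'rV[R]_p => taylor_factor n m (x 0 i - a 0 i)).
Proof.
move=> oU k; rewrite /taylor_factor; case: (m <= n)%N; last exact: (Ck_cst k U (0 : R)).
apply: CkM => //; first exact: Ck_cst.
apply: (@Ck_eq _ _ _ _ _ (fun x : 'rV[R]_p => \prod_(j < n - m) (x 0 i - a 0 i))) => //.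
  by move=> x _; rewrite prodr_const card_ord.
apply: Ck_prod => // j _; apply: CkD => //; first exact: Ck_coord.
exact: (Ck_cst k U (- a 0 i)).
Qed.

Lemma smooth_taylor_monomial a J K U : open U ->
  smooth_on U (taylor_monomial a J K).
Proof.
by move=> oU k; apply: Ck_prod => // i _; exact: smooth_taylor_factor.
Qed.

Lemma derive_taylor_factor (a x : 'rV[R]_p) n m i :
  'D_(ee i) (fun x : 'rV[R]_p => taylor_factor n m (x 0 i - a 0 i)) x =
  taylor_factor n m.+1 (x 0 i - a 0 i).
Proof.
rewrite /taylor_factor; have [mn|mn] := leqP m n; last first.
  rewrite ltnNge (ltnW mn) /=; exact: derive_cst.
have dl : is_derive x (ee i) (fun x : 'rV[R]_p => x 0 i - a 0 i) 1.
  have := is_deriveB (is_derive_coord x (ee i) i) (is_derive_cst (a 0 i) x (ee i)).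
  by rewrite mxE !eqxx subr0.
have [mn'|nm] := ltnP m n; last first.
  have -> : (n - m = 0)%N by apply/eqP; rewrite subn_eq0.
  under eq_fun do rewrite expr0 mulr1.
  exact: derive_cst.
rewrite -(subnSK mn'); set k := (n - m.+1)%N.
have dX : is_derive x (ee i) (fun x : 'rV[R]_p => (x 0 i - a 0 i) ^+ k.+1)
    (k.+1%:R * (x 0 i - a 0 i) ^+ k).
  have := is_deriveX k.+1 dl.
  by rewrite exprfctE /GRing.scale /= mulr1.
have := is_deriveZ ((k.+1)`!%:R)^-1 dX => dZ.
rewrite (@derive_val _ _ _ _ _ _ _ dZ) /GRing.scale /= factS natrM invfM.
by rewrite mulrACA mulVf ?pnatr_eq0// mul1r.
Qed.

Lemma derive_taylor_monomial a J K i x :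
  'D_(ee i) (taylor_monomial a J K) x = taylor_monomial a J (midxS K i) x.
Proof.
pose c (x : 'rV[R]_p) := \prod_(j | j != i) taylor_factor (J j) (K j) (x 0 j - a 0 j).
have sc : smooth_on setT c.
  move=> k; apply: Ck_prod; first exact: openT.
  by move=> j _; apply: smooth_taylor_factor; exact: openT.
have -> : taylor_monomial a J K = (fun x => taylor_factor (J i) (K i) (x 0 i - a 0 i) * c x).
  by apply/funext => y; rewrite /taylor_monomial (bigD1 i).
have dt := smooth_differentiable (smooth_taylor_factor a (J i) (K i) i openT) (I : setT x).
have dc := smooth_differentiable sc (I : setT x).
rewrite deriveM; [|exact: diff_derivable|exact: diff_derivable].
rewrite derive_constant_line; last first.
  move=> t; apply: eq_bigr => j ji; congr taylor_factor.
  by rewrite !mxE (negbTE ji) andbF mulr0 add0r.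
rewrite scaler0 add0r derive_taylor_factor /taylor_monomial (bigD1 i)//=.
rewrite !ffunE eqxx addn1 /GRing.scale /= mulrC; congr (_ * _).
by apply: eq_bigr => j ji; rewrite ffunE (negbTE ji) addn0.
Qed.

(* Truncated at 0: only meaningful when [0 < J i]. *)
Definition midxP (J : midx p) (i : 'I_p) : midx p :=
  [ffun j => (J j - (j == i))%N].

Lemma midxPK (J : midx p) l : (0 < J l)%N -> midxS (midxP J l) l = J.
Proof.
move=> Jl; apply/ffunP => j; rewrite !ffunE; case: eqP => [->|_] /=.
  by rewrite subnK.
by rewrite subn0 addn0.
Qed.

Lemma sum_midxP (J : midx p) l m :
  (0 < J l)%N -> (\sum_i J i)%N = m.+1 -> (\sum_i midxP J l i)%N = m.
Proof. by move=> /midxPK {1}<-; rewrite sum_midxS => -[]. Qed.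

Lemma midx_ind (P : midx p -> Prop) :
  P (midx0 p) -> (forall J i, P J -> P (midxS J i)) -> forall J, P J.
Proof.
move=> P0 PS J; move: {2}(\sum_i J i)%N (erefl (\sum_i J i)%N) => m.
elim: m J => [|m IH] J Jm.
  suff -> : J = midx0 p by [].
  apply/ffunP => i; rewrite ffunE; apply/eqP; rewrite -leqn0 -Jm.
  by rewrite (bigD1 i)//= leq_addr.
have [i Ji] : exists i, (0 < J i)%N.
  apply/existsP; rewrite -[X in is_true X]negbK negb_exists; apply/negP => /forallP J0.
  by move: Jm; rewrite big1// => i _; move: (J0 i); rewrite -leqNgt leqn0 => /eqP.
by rewrite -(midxPK Ji); apply/PS/IH; exact: sum_midxP.
Qed.

(** [g K] is written down as the [K]-th derivative of the Taylor polynomial, so induction on [K]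
    identifies it with [pderiv K (g (midx0 p))]; at the centre only the term J = K survives. The sum
    runs over the box of multi-indices with entries at most [k], a finite type containing all those
    of order at most [k]. *)
Lemma prescribed_jet q (z : jet R p q) (k : nat) :
  exists2 f : 'rV[R]_p -> 'rV[R]_q, smooth_on setT f &
    agree k (jet_graph f (\row_i z (inl i))) z.
Proof.
pose a : 'rV[R]_p := \row_i z (inl i).
pose J_ (J : {ffun 'I_p -> 'I_k.+1}) : midx p := [ffun i => val (J i)].
pose g K x : 'rV[R]_q :=
  \row_al \sum_J z (inr (al, J_ J)) * taylor_monomial a (J_ J) K x.
have gC K j n : Ck n setT (fun x => g K x 0 j).
  apply: (@Ck_eq _ _ _ _ _ (fun x => \sum_J z (inr (j, J_ J)) *
     taylor_monomial a (J_ J) K x)); first exact: openT.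
    by move=> x _; rewrite mxE.
  apply: Ck_sum; first exact: openT.
  move=> J _; apply: CkM; [exact: openT|exact: Ck_cst|].
  by apply: smooth_taylor_monomial; exact: openT.
have sg K : smooth_on setT (g K).
  by move=> n; apply/(Ck_row _ _ openT) => j; exact: gC.
have dg K i x : 'D_(ee i) (g K) x = g (midxS K i) x.
  have dgx := smooth_differentiable (sg K) (I : setT x).
  apply/rowP => j; rewrite derive_row// mxE.
  have dm J : differentiable (taylor_monomial a (J_ J) K) x.
    exact: (smooth_differentiable (smooth_taylor_monomial a (J_ J) K openT) (I : setT x)).
  have -> : (fun y => g K y 0 j) = \sum_(l < #|{ffun 'I_p -> 'I_k.+1}|)
      z (inr (j, J_ (enum_val l))) *: taylor_monomial a (J_ (enum_val l)) K.
    apply/funext => y; rewrite mxE fct_sumE /= (reindex _ (onW_bij _ (enum_val_bij _))).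
    by apply: eq_bigr => l _.
  rewrite derive_sum; last by move=> l; apply/derivableZ/diff_derivable.
  rewrite (reindex _ (onW_bij _ (enum_val_bij {ffun 'I_p -> 'I_k.+1}))).
  apply: eq_bigr => l _; rewrite deriveZ; last exact: diff_derivable.
  by rewrite derive_taylor_monomial.
have pg K x : pderiv K (g (midx0 p)) x = g K x.
  elim/midx_ind: K x => [|K i IH] x; first by rewrite pderiv0.
  rewrite -(derive_pderiv K i openT (sg _) I) -dg.
  exact: derive_ext.
exists (g (midx0 p)) => // -[i|[al K]] /= Kk; first by rewrite mxE.
rewrite pg mxE.
have Ki i : (K i < k.+1)%N by rewrite ltnS (leq_trans _ Kk)// (bigD1 i)//= leq_addr.
pose K' : {ffun 'I_p -> 'I_k.+1} := [ffun i => Ordinal (Ki i)].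
have JK' : J_ K' = K by apply/ffunP => i; rewrite !ffunE.
rewrite (bigD1 K')//= big1 ?addr0; last first.
  move=> J JK; rewrite -/a taylor_monomial_center; case: eqP => [E|_]; last by rewrite mulr0.
  case/eqP: JK; apply/ffunP => i; apply: val_inj.
  by move/ffunP: E => /(_ i); rewrite !ffunE.
by rewrite -/a taylor_monomial_center JK' eqxx mulr1.
Qed.

End Polynomials.

(** * Prolongation of a local map *)

Section Prolongation.
Variables (R : realType) (p q s : nat).
Local Notation ee i := (delta_mx (0 : 'I_1) i).
Variables (L : 'rV[R]_(p + q) -> 'rV[R]_(p + s)) (W : set 'rV[R]_(p + q)).
Hypotheses (oW : open W) (sL : smooth_on W L).
Implicit Types (z : jet R p q) (f : 'rV[R]_p -> 'rV[R]_q) (U : set 'rV[R]_p).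

(* [D0], with an arbitrary smooth map [L] in place of a local representative. *)
Definition tdmx z : 'M[R]_p :=
  \matrix_(i, k)
    (partial L (lshift s k) (lshift q i) (jbase z) +
     \sum_al z (inr (al, midxS (midx0 p) i)) *
             partial L (lshift s k) (rshift p al) (jbase z)).

Definition regjet : set (jet R p q) :=
  [set z | W (jbase z) /\ \det (tdmx z) != 0].

(* The coordinate [w_J^al] of the prolonged jet, where [m] is the order of [J]:
   [w_(J + l) = sum_i (D_0^-1)_(l i) D_i w_J].  That the choice of [l] is
   irrelevant only comes out of [pcoord_graph]. *)
Fixpoint pcoord (m : nat) (al : 'I_s) (J : midx p) z : R :=
  if m is m'.+1 then
    if [pick l | (0 < J l)%N] is Some l then
      \sum_i invmx (tdmx z) l i *
             dform (pcoord m' al (midxP J l)) z (total_vector i z)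
    else 0
  else L (jbase z) 0 (rshift p al).

Definition pjet z : jet R p s := fun A =>
  match A with
  | inl k => L (jbase z) 0 (lshift s k)
  | inr (al, J) => pcoord (\sum_i J i) al J z
  end.

Lemma cylinderT (r k : nat) : cylinder k [set: jet R p r].
Proof. by split=> //; rewrite preimage_setT; exact: openT. Qed.

Lemma jorder_midx0 (r : nat) (al : 'I_r) : jorder (inr (al, midx0 p)) = 0%N.
Proof. by rewrite /= big1// => i _; rewrite ffunE. Qed.

Lemma jorder_midx1 (r : nat) (al : 'I_r) i :
  jorder (inr (al, midxS (midx0 p) i)) = 1%N.
Proof. by rewrite /= sum_midxS big1// => j _; rewrite ffunE. Qed.

Lemma dfun_jbase k E j : dfun k E (fun z => jbase z 0 j).
Proof.
apply: (@dfun_sub _ _ _ _ setT) => //.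
have [i ->|al ->] := split_ordP j.
  apply: (@dfun_eq _ _ _ _ _ (fun z => z (inl i))).
  - exact: cylinderT.
  - by move=> z _; rewrite /jbase row_mxEl mxE.
  - exact: dfun_coord.
apply: (@dfun_eq _ _ _ _ _ (fun z => z (inr (al, midx0 p)))).
- exact: cylinderT.
- by move=> z _; rewrite /jbase row_mxEr mxE.
- by apply: dfun_coord; rewrite jorder_midx0.
Qed.

Lemma cylinder_base k : cylinder k [set z | W (jbase z)].
Proof.
have -> : [set z | W (jbase z)] = setT `&` (@jbase R p q) @^-1` W.
  by rewrite setTI.
apply: cylinder_preimage => //; first exact: cylinderT.
by move=> j; exact: dfun_jbase.
Qed.

Lemma dfun_base k (g : 'rV[R]_(p + q) -> R) :
  smooth_on W g -> dfun k [set z | W (jbase z)] (fun z => g (jbase z)).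
Proof.
move=> sg; apply: (@dfun_comp _ _ _ _ _ _ W g (@jbase R p q)) => //.
- exact: cylinder_base.
- by move=> j; exact: dfun_jbase.
Qed.

Lemma smooth_coord j : smooth_on W (fun y => L y 0 j : R).
Proof. by move=> n; have /(Ck_row _ _ oW)/(_ j) := sL n. Qed.

Lemma dfun_tdmx i k : dfun 1 [set z | W (jbase z)] (fun z => tdmx z i k).
Proof.
have sp j l : smooth_on W (partial L l j).
  exact: smooth_derive (smooth_coord l).
have cB := cylinder_base 1.
apply: (@dfun_eq _ _ _ _ _ (fun z =>
    partial L (lshift s k) (lshift q i) (jbase z) +
     \sum_al z (inr (al, midxS (midx0 p) i)) *
             partial L (lshift s k) (rshift p al) (jbase z))) => //.
  by move=> z _; rewrite mxE.
apply: dfunD => //; first exact: dfun_base.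
apply: dfun_sum => // al; apply: dfunM => //; last exact: dfun_base.
by apply: dfun_coord; rewrite jorder_midx1.
Qed.

Lemma cylinder_regjet k : (0 < k)%N -> cylinder k regjet.
Proof.
move=> k0; apply: (cylinder_lift k0).
(* The determinant is written as a row of length one, the form in which [cylinder_preimage] takes
   its map. *)
have -> : regjet = [set z | W (jbase z)] `&`
    (fun z => \row_(j < 1) \det (tdmx z)) @^-1` [set v : 'rV[R]_1 | v 0 0 != 0].
  by apply/seteqP; split=> z; rewrite /regjet /preimage /= mxE.
apply: cylinder_preimage; first exact: cylinder_base.
  move=> j; apply: (@dfun_eq _ _ _ _ _ (fun z => \det (tdmx z))).
  - exact: cylinder_base.
  - by move=> z _; rewrite mxE.
  split=> [n|z z' zz' Wz].
    by apply: Ck_det; [exact: (cylinder_base 1).2|move=> a b; exact: (dfun_tdmx a b).1].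
  by congr (\det _); apply/matrixP => a b; exact: (dfun_tdmx a b).2.
have := @open_comp _ _ (fun v : 'rV[R]_1 => v 0 0) [set t : R | t != 0].
apply; last exact: open_neq.
by move=> v _; exact: coord_continuous.
Qed.

Lemma dfun_tdmx_inv k i j : (0 < k)%N -> dfun k regjet (fun z => invmx (tdmx z) i j).
Proof.
move=> k0; apply: (dfun_lift k0); first exact: cylinder_regjet.
apply: dfun_invmx => [|a b|z []//]; first exact: cylinder_regjet.
by apply: dfun_sub (dfun_tdmx a b) => z [].
Qed.

(** The domain [regjet] is itself a condition of order one, so the uniform bound [m.+1] is used,
    although the recursion produces no coordinate of order above max(m, 1). Pull-backs below raise
    the order by one for this reason. *)
Lemma dfun_pcoord m al J : dfun m.+1 regjet (pcoord m al J).
Proof.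
elim: m J => [|m IH] J /=.
  apply: (@dfun_sub _ _ _ _ [set z | W (jbase z)]); first by move=> z [].
  exact: dfun_base (smooth_coord _).
case: pickP => [l Jl|_]; last exact: dfun_cst.
have cR : cylinder m.+2 regjet by exact: cylinder_regjet.
apply: dfun_sum => // i; apply: dfunM => //; first exact: dfun_tdmx_inv.
exact: (dfun_total i (cylinder_regjet (ltn0Sn m)) (IH _)).
Qed.

Lemma dfun_pjet A : dfun (jorder A).+1 regjet (fun z => pjet z A).
Proof.
case: A => [k|[al J]] /=; last exact: dfun_pcoord.
apply: (@dfun_sub _ _ _ _ [set z | W (jbase z)]); first by move=> z [].
exact: dfun_base (smooth_coord _).
Qed.

(** * Graphs and their images *)

Definition graph_image f (x : 'rV[R]_p) : 'rV[R]_(p + s) := L (row_mx x (f x)).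

Section Graph.
Variables (f : 'rV[R]_p -> 'rV[R]_q) (U : set 'rV[R]_p).
Hypotheses (oU : open U) (sf : smooth_on U f).
Hypothesis UW : forall x, U x -> W (row_mx x (f x)).

Lemma smooth_graph_map : smooth_on U (fun x => row_mx x (f x)).
Proof.
move=> n; apply/Ck_row => // j; have [i ->|al ->] := split_ordP j.
  by apply: Ck_eq (Ck_coord n U i) => // x _; rewrite row_mxEl.
have /(Ck_row _ _ oU)/(_ al) := sf n.
by apply: Ck_eq => // x _; rewrite row_mxEr.
Qed.

Lemma smooth_graph_image : smooth_on U (graph_image f).
Proof. by move=> n; exact: (Ck_comp oU oW UW (smooth_graph_map n) (sL n)). Qed.

Lemma smooth_lsub_image : smooth_on U (fun x => lsubmx (graph_image f x)).
Proof.
move=> n; apply/Ck_row => // j.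
have /(Ck_row _ _ oU)/(_ (lshift s j)) := smooth_graph_image n.
by apply: Ck_eq => // x _; rewrite mxE.
Qed.

Lemma smooth_rsub_image : smooth_on U (fun x => rsubmx (graph_image f x)).
Proof.
move=> n; apply/Ck_row => // j.
have /(Ck_row _ _ oU)/(_ (rshift p j)) := smooth_graph_image n.
by apply: Ck_eq => // x _; rewrite mxE.
Qed.

(** Total derivatives along a graph are ordinary derivatives of x |-> L(x, f(x)): the x-part of the
    chain rule gives the first summand of [tdmx], the u-part the sum over [al]. *)
Lemma jac_lsub_image x : U x ->
  jac (fun x => lsubmx (graph_image f x)) x = tdmx (jet_graph f x).
Proof.
move=> Ux; apply/matrixP => i k; rewrite !mxE.
have dg := smooth_differentiable smooth_graph_map Ux.
have dL := smooth_differentiable (smooth_coord (lshift s k)) (UW Ux).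
transitivity ('D_(ee i) ((fun y => L y 0 (lshift s k) : R) \o
    (fun x => row_mx x (f x))) x).
  by apply: derive_ext => y; rewrite /= mxE.
rewrite (derive_chain _ dg dL) (derive_partials _ dL) big_split_ord /= jbase_graph.
congr (_ + _).
  rewrite (bigD1 i)//= big1 ?addr0.
    rewrite derive_row//; under eq_fun do rewrite row_mxEl.
    by rewrite (@derive_val _ _ _ _ _ _ _ (is_derive_coord x (ee i) i)) mxE !eqxx mul1r.
  move=> l li; rewrite derive_row//; under eq_fun do rewrite row_mxEl.
  rewrite (@derive_val _ _ _ _ _ _ _ (is_derive_coord x (ee i) l)) mxE.
  by rewrite (negbTE li) andbF mul0r.
apply: eq_bigr => al _; congr (_ * _).
rewrite derive_row//; under eq_fun do rewrite row_mxEr.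
rewrite -(derive_pderiv _ i oU sf Ux) pderiv0 derive_row//.
exact: smooth_differentiable sf Ux.
Qed.

Lemma open_jet_graph k (E : set (jet R p q)) :
  cylinder k E -> open (U `&` [set x | E (jet_graph f x)]).
Proof.
move=> [aE oE]; rewrite openE => x [Ux Ex]; apply: filterI.
  exact: open_nbhs_nbhs.
have ct : {for x, continuous (fun y => jtrunc k (jet_graph f y))}.
  apply: differentiable_continuous; apply/differentiable_row => j.
  under eq_fun do rewrite mxE.
  exact: differentiable_jet_graph oU sf Ux.
have Ev : E (jext (jtrunc k (jet_graph f x))).
  by apply: aE Ex; exact/agree_sym/jext_trunc.
apply: filterS (near_preimage ct oE Ev) => y; apply: aE.
exact: jext_trunc.
Qed.

End Graph.

(** Only the inclusion of the image of the graph of [f] in the graph of [h] is recorded, so the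
    record can be built both from the inverse function theorem and from a relation known merely near
    a point. *)
Record image_graph f (h : 'rV[R]_p -> 'rV[R]_s) U U' : Prop := ImageGraph {
  ig_open : open U;
  ig_open' : open U';
  ig_smooth : smooth_on U f;
  ig_smooth' : smooth_on U' h;
  ig_reg : forall x, U x -> regjet (jet_graph f x);
  ig_dom : forall x, U x -> U' (lsubmx (graph_image f x));
  ig_eq : forall x, U x -> h (lsubmx (graph_image f x)) = rsubmx (graph_image f x) }.

Section ImageGraph.
Variables (f : 'rV[R]_p -> 'rV[R]_q) (h : 'rV[R]_p -> 'rV[R]_s).
Variables (U U' : set 'rV[R]_p).
Hypothesis H : image_graph f h U U'.
Local Notation Y := (fun x => lsubmx (graph_image f x)).

Lemma ig_base x : U x -> W (row_mx x (f x)).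
Proof. by move=> /(ig_reg H)[]; rewrite jbase_graph. Qed.

Lemma differentiable_image x : U x -> differentiable Y x.
Proof.
exact: (smooth_differentiable (smooth_lsub_image (ig_open H) (ig_smooth H) ig_base)).
Qed.

Lemma derive_image_coord x i l : U x ->
  'D_(ee i) Y x 0 l = tdmx (jet_graph f x) i l.
Proof.
move=> Ux; rewrite -(jac_lsub_image (ig_open H) (ig_smooth H) ig_base Ux).
by rewrite mxE derive_row//; exact: differentiable_image.
Qed.

Lemma derive_along_image x i A : U x ->
  'D_(ee i) (fun y => jet_graph h (Y y) A : R) x =
  \sum_l tdmx (jet_graph f x) i l * total_vector l (jet_graph h (Y x)) A.
Proof.
move=> Ux; have U'Y := ig_dom H Ux.
have dh := differentiable_jet_graph A (ig_open' H) (ig_smooth' H) U'Y.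
rewrite (derive_chain (ee i) (differentiable_image Ux) dh) (derive_partials _ dh).
apply: eq_bigr => l _; rewrite derive_image_coord//; congr (_ * _).
exact: derive_jet_graph (ig_open' H) (ig_smooth' H) U'Y.
Qed.

Lemma derive_along_graph k E F x i : cylinder k E -> dfun k E F ->
  U x -> E (jet_graph f x) ->
  'D_(ee i) (fun y => F (jet_graph f y)) x =
  dform F (jet_graph f x) (total_vector i (jet_graph f x)).
Proof.
move=> cE dF Ux Ex.
have dg A := differentiable_jet_graph A (ig_open H) (ig_smooth H) Ux.
rewrite (derive_dfun (ee i) cE dF Ex dg).2; congr dform.
apply/funext => A; exact: derive_jet_graph (ig_open H) (ig_smooth H) Ux.
Qed.

(** The induction hypothesis for J' = [midxP J l] holds near [x] and can be differentiated: D_0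
    times the column [w] of the derivatives of [h] of index J' + k is the column of the D_i of
    [pcoord m al J']. Row [l] of the inverse of D_0 recovers the derivative of index [J], whichever
    [l] was picked. *)
Lemma pcoord_graph m al (J : midx p) x : (\sum_i J i)%N = m -> U x ->
  jet_graph h (Y x) (inr (al, J)) = pcoord m al J (jet_graph f x).
Proof.
elim: m J x => [|m IH] J x Jm Ux.
  have -> : J = midx0 p.
    apply/ffunP => i; rewrite ffunE; apply/eqP; rewrite -leqn0 -Jm.
    by rewrite (bigD1 i)//= leq_addr.
  by rewrite /= pderiv0 (ig_eq H Ux) mxE jbase_graph.
rewrite [RHS]/=; case: pickP => [l Jl|J0]; last first.
  by move: Jm; rewrite big1// => i _; move: (J0 i); rewrite lt0n => /negbFE/eqP.
have Jm' := sum_midxP Jl Jm.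
have D i : \sum_k tdmx (jet_graph f x) i k *
      total_vector k (jet_graph h (Y x)) (inr (al, midxP J l)) =
    dform (pcoord m al (midxP J l)) (jet_graph f x)
      (total_vector i (jet_graph f x)).
  rewrite -derive_along_image//.
  rewrite -(derive_along_graph i (cylinder_regjet (ltn0Sn m))
    (dfun_pcoord m al (midxP J l)) Ux (ig_reg H Ux)).
  apply: near_eq_derive; apply: (open_near (ig_open H) Ux) => y Uy.
  exact: IH.
under eq_bigr do rewrite -D.
have uT : tdmx (jet_graph f x) \in unitmx.
  by rewrite unitmxE unitfE; have [] := ig_reg H Ux.
pose w : 'cV[R]_p := \col_k total_vector k (jet_graph h (Y x)) (inr (al, midxP J l)).
have := mulKmx uT w => /matrixP/(_ l 0); rewrite [RHS]mxE /= midxPK// => <-.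
rewrite mxE; apply: eq_bigr => i _; congr (_ * _).
rewrite [LHS]mxE; apply: eq_bigr => k _; congr (_ * _).
by rewrite /w mxE.
Qed.

Lemma pjet_graph x : U x -> jet_graph h (Y x) = pjet (jet_graph f x).
Proof.
move=> Ux; apply/funext => -[k|[al J]]; last exact: pcoord_graph.
by rewrite /= jbase_graph mxE.
Qed.

End ImageGraph.

(** The inverse [g] of x |-> y(x) is returned along with [h]: it shows that every point of the graph
    of [h] over [V'] comes from the graph of [f], the inclusion missing from [image_graph]. *)
Lemma image_graph_exists f U x0 : open U -> U x0 -> smooth_on U f ->
  regjet (jet_graph f x0) ->
  exists V V' h g, [/\ image_graph f h V V', V x0, V `<=` U,
    (forall x, V x -> g (lsubmx (graph_image f x)) = x) &
    [/\ smooth_on V' g, (forall b, V' b -> V (g b)) &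
        forall b, V' b -> lsubmx (graph_image f (g b)) = b]].
Proof.
move=> oU Ux0 sf reg0.
pose U1 := U `&` [set x | regjet (jet_graph f x)].
have oU1 : open U1 := open_jet_graph oU sf (cylinder_regjet (ltn0Sn 0)).
have sf1 : smooth_on U1 f by move=> n; apply: Ck_sub (sf n) => x [].
have UW x : U1 x -> W (row_mx x (f x)).
  by move=> [_ []]; rewrite jbase_graph.
have U1x0 : U1 x0 by [].
have det0 : \det (jac (fun x => lsubmx (graph_image f x)) x0) != 0.
  by rewrite (jac_lsub_image oU1 sf1 UW U1x0); have [] := reg0.
have [V [V' [g [[oV Vx0 VU1 oV' sg] [gY Yg]]]]] :=
  inverse_function oU1 U1x0 (smooth_lsub_image oU1 sf1 UW) det0.
have gV b : V' b -> V (g b) by case/Yg.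
have Yg' b : V' b -> lsubmx (graph_image f (g b)) = b by case/Yg.
have gY' x : V x -> g (lsubmx (graph_image f x)) = x by case/gY.
have IG : image_graph f (fun b => rsubmx (graph_image f (g b))) V V'.
  apply: ImageGraph.
  - exact: oV.
  - exact: oV'.
  - by move=> n; apply: Ck_sub (sf1 n).
  - move=> n; apply: (Ck_comp oV' oU1 _ (sg n) (smooth_rsub_image oU1 sf1 UW n)).
    by move=> b /gV/VU1.
  - by move=> x /VU1[].
  - by move=> x /gY[].
  - by move=> x /gY' ->.
exists V, V', (fun b => rsubmx (graph_image f (g b))), g.
split; [exact: IG|exact: Vx0|by move=> x /VU1[]|exact: gY'|].
by split; [exact: sg|exact: gV|exact: Yg'].
Qed.

Lemma dform_agree k E F z z' i : cylinder k E -> dfun k E F -> E z ->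
  agree k.+1 z z' ->
  dform F z (total_vector i z) = dform F z' (total_vector i z').
Proof. by move=> cE dF Ez zz'; exact: (dfun_total i cE dF).2. Qed.

(** Both sides depend on finitely many coordinates of [z], so [z] may be replaced by the jet of a
    polynomial graph. There the left side is a derivative of the prolonged image graph at y(x), and
    the chain rule gives the right side. *)
Lemma dform_pjet z A i : regjet z ->
  dform (fun z' => pjet z' A) z (total_vector i z) =
  \sum_l tdmx z i l * total_vector l (pjet z) A.
Proof.
(* Both sides have order at most [(jorder A).+2]: on the left, D_i of a function of order
   [(jorder A).+1]; on the right, coordinates of [pjet] of order at most [(jorder A).+1]. The value
   chosen leaves a margin of one. *)
move=> rz; set k := (jorder A).+3.
have [f sf zf] := prescribed_jet z k.
set x := \row_i z (inl i) in zf.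
have rx : regjet (jet_graph f x).
  apply: (cylinder_regjet (ltn0Sn k.-1)).1 rz; exact: agree_sym.
have [V [V' [h [g [H Vx _ _ _]]]]] := image_graph_exists openT I sf rx.
have zfk : agree (jorder A).+2 (jet_graph f x) z by exact: agreeW zf.
rewrite -(dform_agree i (cylinder_regjet (ltn0Sn _)) (dfun_pjet A) rx zfk).
rewrite -(derive_along_graph H i (cylinder_regjet (ltn0Sn _)) (dfun_pjet A) Vx rx).
transitivity ('D_(ee i) (fun y => jet_graph h (lsubmx (graph_image f y)) A : R) x).
  apply: near_eq_derive; apply: (open_near (ig_open H) Vx) => y Vy.
  by rewrite (pjet_graph H Vy).
rewrite (derive_along_image H _ _ Vx); apply: eq_bigr => l _; congr (_ * _).
  apply: (dfun_tdmx i l).2; last by have [] := rx.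
  exact: agreeW zf.
rewrite (pjet_graph H Vx); apply: (@total_vector_order _ _ _ (jorder A)) => // B BA.
apply: (dfun_pjet B).2 rx; apply: agreeW zf.
by rewrite /k; exact: (leq_trans BA).
Qed.

End Prolongation.

(** * Prolongation in charts *)

Section Charts.
Variables (R : realType) (p q s : nat).
Local Notation ee i := (delta_mx (0 : 'I_1) i).

Lemma near_continuous (T T' : topologicalType) (f : T -> T') (P : T' -> Prop)
    (x : T) (y : T') :
  {for x, continuous f} -> f x = y -> (\forall y' \near y, P y') ->
  \forall x' \near x, P (f x').
Proof. by move=> cf <-; exact: cf. Qed.

Lemma cinvK (d : nat) (T : topologicalType) (c : chart R d T) v :
  cimg c v -> cmap c (cinv c v) = v.
Proof. by move=> [a ca <-]; rewrite cmapK. Qed.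

Lemma cinv_dom (d : nat) (T : topologicalType) (c : chart R d T) v :
  cimg c v -> cdom c (cinv c v).
Proof. by move=> [a ca <-]; rewrite cmapK. Qed.

Definition ldom (d e : nat) (T T' : topologicalType) (c : chart R d T)
    (c' : chart R e T') (Phi : T -> T') : set 'rV[R]_d :=
  [set v | cimg c v /\ cdom c' (Phi (cinv c v))].

Lemma open_ldom (d e : nat) (T T' : topologicalType) (c : chart R d T)
    (c' : chart R e T') (Phi : T -> T') : continuous Phi -> open (ldom c c' Phi).
Proof.
move=> cPhi; rewrite openE => v [cv dv]; apply: filterI.
  by apply: open_nbhs_nbhs; split=> //; exact: cimg_open.
have cP : {for v, continuous (Phi \o cinv c)}.
  by apply: continuous_comp; [exact: cinv_cont|exact: cPhi].
exact: (near_preimage cP (cdom_open c') dv).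
Qed.

Lemma ldomE (d e : nat) (T T' : topologicalType) (c : chart R d T)
    (c' : chart R e T') (Phi : T -> T') :
  ldom c c' Phi = cmap c @` (cdom c `&` Phi @^-1` cdom c').
Proof.
apply/seteqP; split=> v.
  move=> [cv dv]; exists (cinv c v); last exact: cinvK.
  by split; first exact: cinv_dom.
move=> [a [ca da] <-]; split; first by exists a.
by rewrite cmapK.
Qed.

Section Map.
Variables (M : manifold R (p + q)) (N : manifold R (p + s)).
Variables (c : chart R (p + q) M) (c' : chart R (p + s) N) (Phi : M -> N).
Hypotheses (hc : coordinates c) (hc' : coordinates c') (sPhi : smooth_map Phi).
Implicit Types (z : jet R p q) (f : 'rV[R]_p -> 'rV[R]_q) (U : set 'rV[R]_p).

Local Notation L := (lrep c c' Phi).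
Local Notation W := (ldom c c' Phi).

Lemma ldom_open : open W.
Proof. exact: open_ldom sPhi.1. Qed.

Lemma smooth_lrep : smooth_on W L.
Proof.
rewrite ldomE; exact: sPhi.2.
Qed.

Local Notation reg := (regjet L W).
Local Notation pj := (pjet L).
Local Notation gi := (graph_image L).

(** All the conditions of [image_graph] hold near [x0], those on jets because they are open and of
    finite order; the interior of the set where they hold is the new domain. *)
Lemma image_graph_near f h U U' x0 : open U -> U x0 -> smooth_on U f ->
  open U' -> smooth_on U' h -> reg (jet_graph f x0) -> U' (lsubmx (gi f x0)) ->
  (\forall x \near x0, h (lsubmx (gi f x)) = rsubmx (gi f x)) ->
  exists2 V, image_graph L W f h V U' & V x0.
Proof.
move=> oU Ux0 sf oU' sh rx0 U'x0 hE.
have oW := ldom_open; have sL := smooth_lrep.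
pose U1 := U `&` [set x | reg (jet_graph f x)].
have oU1 : open U1 := open_jet_graph oU sf (cylinder_regjet oW sL (ltn0Sn 0)).
have sf1 : smooth_on U1 f by move=> n; apply: Ck_sub (sf n) => x [].
have UW x : U1 x -> W (row_mx x (f x)).
  by move=> [_ []]; rewrite jbase_graph.
have U1x0 : U1 x0 by [].
have cY : {for x0, continuous (fun x => lsubmx (gi f x))}.
  exact: smooth_continuous (smooth_lsub_image oW sL oU1 sf1 UW) U1x0.
have nV : \forall x \near x0, [/\ U1 x, U' (lsubmx (gi f x)) &
    h (lsubmx (gi f x)) = rsubmx (gi f x)].
  have n1 : \forall x \near x0, U1 x by exact: open_nbhs_nbhs.
  have n2 := near_preimage cY oU' U'x0.
  by apply: filterS2 (filterI n1 n2) hE => x [].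
exists (interior [set x | [/\ U1 x, U' (lsubmx (gi f x)) &
    h (lsubmx (gi f x)) = rsubmx (gi f x)]]); last exact: nV.
apply: ImageGraph.
- exact: open_interior.
- exact: oU'.
- by move=> n; apply: Ck_sub (sf1 n) => x /interior_subset[].
- exact: sh.
- by move=> x /interior_subset[[]].
- by move=> x /interior_subset[].
- by move=> x /interior_subset[].
Qed.

Lemma local_graph_base S a f : local_graph c S a f ->
  cmap c a = row_mx (lsubmx (cmap c a)) (f (lsubmx (cmap c a))).
Proof.
by move=> [Sa ca _ /nbhs_singleton -[/(_ Sa) <- _]]; rewrite hsubmxK.
Qed.

Lemma local_graph_points S a f : local_graph c S a f ->
  \forall x \near lsubmx (cmap c a), cimg c (row_mx x (f x)) /\
    S (cinv c (row_mx x (f x))).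
Proof.
move=> H; have E := local_graph_base H; case: H => Sa ca [U [oU Ux0 sf]] nS.
set x0 := lsubmx (cmap c a) in E Ux0 *.
have cg : {for x0, continuous (fun x => row_mx x (f x))}.
  have h : Ck 0 U (fun x => row_mx x (f x)) by exact: smooth_graph_map.
  exact: h.
have ci : cimg c (row_mx x0 (f x0)) by rewrite -E; exists a.
have n1 := near_preimage cg (@cimg_open _ _ _ c) ci.
have cc : {for x0, continuous (fun x => cinv c (row_mx x (f x)))}.
  by apply: (continuous_comp cg); exact: cinv_cont.
have n2 : \forall x \near x0, S (cinv c (row_mx x (f x))) <->
   rsubmx (cmap c (cinv c (row_mx x (f x)))) =
   f (lsubmx (cmap c (cinv c (row_mx x (f x))))).
  by apply: (near_continuous cc _ nS); rewrite -E cmapK.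
apply: filterS2 n1 n2 => x ix Sx; split => //; apply/Sx.
by rewrite cinvK// row_mxKl row_mxKr.
Qed.

Lemma derive_graph_image f U x v : open U -> U x -> smooth_on U f ->
  (forall y, U y -> W (row_mx y (f y))) ->
  'd L (row_mx x (f x)) (row_mx v ('d f x v)) = 'D_v (gi f) x.
Proof.
move=> oU Ux sf UW.
have dg := smooth_differentiable (smooth_graph_map oU sf) Ux.
have dL := smooth_differentiable smooth_lrep (UW _ Ux).
have df := smooth_differentiable sf Ux.
rewrite (derive_chain v dg dL) deriveE//; congr ('d _ _ _).
apply/rowP => j; rewrite derive_row//; have [i ->|al ->] := split_ordP j.
  rewrite row_mxEl; under derive_ext do rewrite row_mxEl.
  by rewrite (@derive_val _ _ _ _ _ _ _ (is_derive_coord x v i)).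
rewrite row_mxEr; under derive_ext do rewrite row_mxEr.
by rewrite -derive_row// deriveE.
Qed.

Lemma lsub_derive_graph_image f U x v : open U -> U x -> smooth_on U f ->
  (forall y, U y -> W (row_mx y (f y))) ->
  lsubmx ('D_v (gi f) x) = v *m tdmx L (jet_graph f x).
Proof.
move=> oU Ux sf UW; have oW := ldom_open; have sL := smooth_lrep.
rewrite -(jac_lsub_image oW sL oU sf UW Ux).
have dY := smooth_differentiable (smooth_lsub_image oW sL oU sf UW) Ux.
have dgi := smooth_differentiable (smooth_graph_image oW sL oU sf UW) Ux.
rewrite -derive_jac//; apply/rowP => j; rewrite [LHS]mxE !derive_row//.
by apply: derive_ext => y; rewrite mxE.
Qed.

Lemma det0_mul_row (B : 'M[R]_p) : (forall v : 'rV[R]_p, v *m B = 0 -> v = 0) ->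
  \det B != 0.
Proof.
move=> H; apply/negP => /det0P[v /negP v0 /H vE]; apply: v0; exact/eqP.
Qed.

(** Translates the geometric definition, with submanifolds and tangent spaces, into functions [f]
    and [h] with graphs related by the local representative. *)
Lemma prolongs_uptoP k z w : prolongs_upto c c' Phi k z w ->
  exists f h U U', [/\ image_graph L W f h U U', U (\row_i z (inl i)),
    agree k z (jet_graph f (\row_i z (inl i))) &
    agree k w (pj (jet_graph f (\row_i z (inl i))))].
Proof.
move=> [S [a [[f lf zf] reg_a [h lh wh]]]].
have oW := ldom_open; have sL := smooth_lrep.
set x0 := lsubmx (cmap c a) in zf; have E := local_graph_base lf; rewrite -/x0 in E.
have x0E : \row_i z (inl i) = x0 by apply/rowP => i; rewrite mxE zf.
case: (lf) => Sa ca [U [oU Ux0 sf]] nS.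
case: (lh) => PSa ca' [U' [oU' U'y0 sh]] nPS.
have Wx0 : W (row_mx x0 (f x0)) by rewrite -E; split; [exists a|rewrite cmapK].
pose U1 := U `&` [set x | W (jbase (jet_graph f x))].
have oU1 : open U1 := open_jet_graph oU sf (cylinder_base oW 0).
have sf1 : smooth_on U1 f by move=> n; apply: Ck_sub (sf n) => x [].
have UW x : U1 x -> W (row_mx x (f x)) by move=> [_ /=]; rewrite jbase_graph.
have U1x0 : U1 x0 by split=> //; rewrite /= jbase_graph.
have giE x : gi f x = cmap c' (Phi (cinv c (row_mx x (f x)))) by [].
have gx0 : gi f x0 = cmap c' (Phi a) by rewrite giE -E cmapK.
have hY : \forall x \near x0, h (lsubmx (gi f x)) = rsubmx (gi f x).
  have cP : {for x0, continuous (fun x => Phi (cinv c (row_mx x (f x))))}.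
    have cg := smooth_continuous (smooth_graph_map oU1 sf1) U1x0.
    have cc : {for x0, continuous (fun x => cinv c (row_mx x (f x)))}.
      by apply: (continuous_comp cg); apply: cinv_cont; case: Wx0.
    by apply: (continuous_comp cc); exact: sPhi.1.
  have n2 : \forall x \near x0, (Phi @` S) (Phi (cinv c (row_mx x (f x)))) <->
      rsubmx (gi f x) = h (lsubmx (gi f x)).
    by apply: (near_continuous cP _ nPS); rewrite -E cmapK.
  apply: filterS2 (local_graph_points lf) n2 => x [_ Sx] [H _].
  by rewrite -H//; exists (cinv c (row_mx x (f x))).
have dY := smooth_differentiable (smooth_lsub_image oW sL oU1 sf1 UW) U1x0.
have dgi := smooth_differentiable (smooth_graph_image oW sL oU1 sf1 UW) U1x0.
(* If v D_0 = 0, then y(x) has zero derivative along [v], and so has the second block h(y(x)). Thus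
   the differential of [Phi] kills the tangent vector above [v], and regularity gives v = 0. *)
have rx0 : reg (jet_graph f x0).
  split; first by rewrite jbase_graph.
  apply: det0_mul_row => v vB.
  have lv : lsubmx ('D_v (gi f) x0) = 0.
    by rewrite (lsub_derive_graph_image v oU1 U1x0 sf1 UW).
  have dYv : 'D_v (fun x => lsubmx (gi f x)) x0 = 0.
    rewrite -lv; apply/rowP => j; rewrite [RHS]mxE !derive_row//.
    by apply: derive_ext => y; rewrite mxE.
  have rv : rsubmx ('D_v (gi f) x0) = 0.
    have dh : differentiable h (lsubmx (gi f x0)).
      by rewrite gx0; exact: smooth_differentiable sh U'y0.
    have dZ := smooth_differentiable (smooth_rsub_image oW sL oU1 sf1 UW) U1x0.
    have -> : rsubmx ('D_v (gi f) x0) = 'D_v (fun x => rsubmx (gi f x)) x0.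
      apply/rowP => j; rewrite [LHS]mxE !derive_row//.
      by apply: derive_ext => y; rewrite mxE.
    rewrite -(near_eq_derive v hY) (derive_chain v dY dh) dYv.
    by rewrite deriveE// linear0.
  have T : tangent c S a (row_mx v ('d f x0 v)) by exists f => //; exists v.
  have := reg_a _ T; rewrite E (derive_graph_image v oU1 U1x0 sf1 UW).
  rewrite -[X in X = 0 -> _]hsubmxK lv rv row_mx0 => /(_ erefl) /(congr1 lsubmx).
  by rewrite row_mxKl linear0.
have U'x0 : U' (lsubmx (gi f x0)) by rewrite gx0.
have [V IG Vx0] := image_graph_near oU Ux0 sf oU' sh rx0 U'x0 hY.
exists f, h, V, U'; rewrite x0E; split=> //.
by rewrite -(pjet_graph oW sL IG Vx0) gx0.
Qed.

(** As the submanifold may change with the order, the coordinates of [w] are treated one at a time: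
    order [(jorder A).+1] determines the coordinate [A] of [pj], and order 1 decides membership in
    [reg]. *)
Lemma prolongs_unique z w : prolongs c c' Phi z w -> reg z /\ w = pj z.
Proof.
have oW := ldom_open; have sL := smooth_lrep.
move=> H.
have rz : reg z.
  have [f [h [U [U' [IG Ux zf _]]]]] := prolongs_uptoP (H 1%N).
  exact: (cylinder_regjet oW sL (ltn0Sn 0)).1 (agree_sym zf) (ig_reg IG Ux).
split=> //; apply/funext => A.
have [f [h [U [U' [IG Ux zf wf]]]]] := prolongs_uptoP (H (jorder A).+1).
rewrite wf//; apply: (dfun_pjet oW sL A).2; last exact: (ig_reg IG Ux).
exact: agree_sym.
Qed.

Lemma prolongs_exists z : reg z -> prolongs c c' Phi z (pj z).
Proof.
have oW := ldom_open; have sL := smooth_lrep.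
(* One order more than [k], because a coordinate of order [k] of [pj] is controlled through
   coordinates of order k + 1. *)
move=> rz k; have [f sf fz] := prescribed_jet z k.+1.
set x0 := \row_i z (inl i) in fz.
have rx0 : reg (jet_graph f x0).
  exact: (cylinder_regjet oW sL (ltn0Sn k)).1 (agree_sym fz) rz.
have zE : jbase z = row_mx x0 (f x0).
  rewrite -(jbase_graph f x0); congr row_mx; apply/rowP => j; rewrite !mxE fz//.
  by rewrite jorder_midx0.
have [V [V' [h [g [IG Vx0 _ gY [sg gV Yg]]]]]] :=
  image_graph_exists oW sL openT I sf rx0.
have Wx0 : W (row_mx x0 (f x0)) by case: rz => Wz _; rewrite -zE.
have VW : forall y, V y -> W (row_mx y (f y)) := ig_base IG.
pose a := cinv c (row_mx x0 (f x0)).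
have aE : cmap c a = row_mx x0 (f x0) by apply: cinvK; case: Wx0.
have lx0 : lsubmx (cmap c a) = x0 by rewrite aE row_mxKl.
have ca : cdom c a by apply: cinv_dom; case: Wx0.
(* The graph is cut down to the part over [V], so that all of its image lies on the graph of [h]. *)
pose S := [set b | [/\ cdom c b, V (lsubmx (cmap c b)) &
   rsubmx (cmap c b) = f (lsubmx (cmap c b))]].
have Sa : S a by split; rewrite // aE ?row_mxKl ?row_mxKr.
have lf : local_graph c S a f.
  split => //; first by exists setT; split=> //; exact: openT.
  have cl : {for a, continuous (fun b => lsubmx (cmap c b))}.
    exact: (continuous_comp (cmap_cont ca) (@continuous_lsubmx _ _ _ _ _)).
  have Va : V (lsubmx (cmap c a)) by rewrite lx0.
  have n1 := near_preimage cl (ig_open IG) Va.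
  have n2 : \forall b \near a, cdom c b.
    by apply: open_nbhs_nbhs; split=> //; exact: cdom_open.
  by apply: filterS2 n1 n2 => b Vb cb; split=> [[]|].
have giE x : gi f x = cmap c' (Phi (cinv c (row_mx x (f x)))) by [].
have gx0 : gi f x0 = cmap c' (Phi a) by [].
have SgE b : S b -> cmap c' (Phi b) = gi f (lsubmx (cmap c b)).
  by move=> [cb _ fb]; rewrite giE -fb hsubmxK cmapK.
have Sgi x : V x -> S (cinv c (row_mx x (f x))).
  move=> Vx; have [cx _] := VW _ Vx.
  by split; [exact: cinv_dom|rewrite cinvK// row_mxKl|rewrite cinvK// row_mxKr row_mxKl].
exists S, a; split.
- exists f => // A Ak; rewrite lx0 fz//; exact: leqW.
(* [tangent] admits any function [f'] presenting [S] near [a]; it agrees with [f] near [x0], hence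
   has the same differential there. *)
- move=> t [f' lf' [v ->]]; rewrite lx0 => dt.
  have ff' : \forall x \near x0, f' x = f x.
    have := local_graph_points lf; rewrite lx0 => n1.
    case: (lf') => _ _ _ n2.
    have cc : {for x0, continuous (fun x => cinv c (row_mx x (f x)))}.
      have cg := smooth_continuous (smooth_graph_map openT sf) (I : setT x0).
      by apply: (continuous_comp cg); apply: cinv_cont; case: Wx0.
    have {}n2 : \forall x \near x0, S (cinv c (row_mx x (f x))) <->
       rsubmx (cmap c (cinv c (row_mx x (f x)))) =
       f' (lsubmx (cmap c (cinv c (row_mx x (f x))))).
      exact: (near_continuous cc _ n2).
    apply: filterS2 n1 n2 => x [ix Sx] [/(_ Sx) + _].
    by rewrite cinvK// row_mxKl row_mxKr.
  have df := smooth_differentiable sf (I : setT x0).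
  have df'E : 'd f' x0 v = 'd f x0 v.
    have df' : differentiable f' x0.
      by apply: differentiable_near_eq df; apply: filterS ff'.
    exact: etrans (esym (deriveE v df')) (etrans (near_eq_derive v ff') (deriveE v df)).
  move: dt; rewrite df'E aE.
  have sfV : smooth_on V f by exact: ig_smooth IG.
  rewrite (derive_graph_image v (ig_open IG) Vx0 sfV VW).
  move=> /(congr1 lsubmx); rewrite (lsub_derive_graph_image v (ig_open IG) Vx0 sfV VW).
  rewrite linear0 => vB.
  have uB : tdmx L (jet_graph f x0) \in unitmx.
    by rewrite unitmxE unitfE; case: rx0.
  have -> : v = 0 by rewrite -[v](mulmxK uB) vB mul0mx.
  by rewrite linear0 row_mx0.
- exists h.
    split.
    + by exists a.
    + by case: Wx0.
    + exists V'; split; [exact: ig_open' IG| |exact: ig_smooth' IG].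
      by rewrite -gx0; exact: ig_dom IG _ Vx0.
    + have ca' : cdom c' (Phi a) by case: Wx0.
      have cl : {for Phi a, continuous (fun b => lsubmx (cmap c' b))}.
        exact: (continuous_comp (cmap_cont ca') (@continuous_lsubmx _ _ _ _ _)).
      have V'a : V' (lsubmx (cmap c' (Phi a))) by rewrite -gx0; exact: ig_dom IG _ Vx0.
      have n1 := near_preimage cl (ig_open' IG) V'a.
      have n2 : \forall b \near Phi a, cdom c' b.
        by apply: open_nbhs_nbhs; split=> //; exact: cdom_open.
      apply: filterS2 n1 n2 => b V'b cb; split.
        move=> [b0 Sb0 <-]; rewrite SgE//; apply/esym/(ig_eq IG).
        by case: Sb0.
      (* Conversely, a point of the graph of [h] over [V'] is the image of the point of [S] above
         g(b), because [g] inverts x |-> y(x). *)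
      move=> bE; have Vx := gV _ V'b; set x := g _ in Vx.
      exists (cinv c (row_mx x (f x))); first exact: Sgi.
      have cx : cdom c' (Phi (cinv c (row_mx x (f x)))) by case: (VW _ Vx).
      rewrite -(cmapK cx) -[RHS](cmapK cb) -giE; congr cinv.
      by rewrite -[LHS]hsubmxK -[RHS]hsubmxK -(ig_eq IG Vx) (Yg _ V'b) -bE.
  move=> A Ak; rewrite -gx0 (pjet_graph oW sL IG Vx0).
  apply: (dfun_pjet oW sL A).2 rz; apply: agreeW (agree_sym fz).
  by rewrite ltnS.
Qed.

Lemma prolongE z : reg z -> prolong c c' Phi z = pj z.
Proof.
move=> rz; rewrite /prolong; case: xgetP => [w _ /prolongs_unique[]//|H].
by case: (H (pj z)); exact: prolongs_exists.
Qed.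

(** * Pull-back of domains, functions and one-forms *)

Lemma nonsingular_preimageE E :
  nonsingular_preimage c c' Phi E = [set z | reg z /\ E (pj z)].
Proof.
apply/seteqP; split=> z.
  move=> [cz dz detz Ez]; have rz : reg z by split.
  by split=> //; rewrite -prolongE.
by move=> [rz Ez]; case: (rz) => -[cz dz] detz; split=> //; rewrite prolongE.
Qed.

Lemma cylinder_nonsingular k E : cylinder k E ->
  cylinder k.+1 (nonsingular_preimage c c' Phi E).
Proof.
have oW := ldom_open; have sL := smooth_lrep.
move=> [aE oE]; rewrite nonsingular_preimageE.
have -> : [set z | reg z /\ E (pj z)] =
    reg `&` (fun z => jtrunc k (pj z)) @^-1` (@jext _ _ _ k @^-1` E).
  apply/seteqP; split=> z [rz Ez]; split=> //; apply: aE Ez.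
    exact/agree_sym/jext_trunc.
  exact: jext_trunc.
apply: cylinder_preimage; [exact: cylinder_regjet| |exact: oE].
move=> j; apply: (@dfun_eq _ _ _ _ _ (fun z => pj z (jidxk_val (enum_val j)))).
- exact: cylinder_regjet.
- by move=> z _; rewrite mxE.
- have Jk : (jorder (jidxk_val (enum_val j)) < k.+1)%N by rewrite ltnS jidxk_val_order.
  exact: (dfun_lift Jk (cylinder_regjet oW sL (ltn0Sn _)) (dfun_pjet oW sL _)).
Qed.

Lemma dfun_pullback k E F : cylinder k E -> dfun k E F ->
  dfun k.+1 (nonsingular_preimage c c' Phi E) (F \o pj).
Proof.
have oW := ldom_open; have sL := smooth_lrep.
move=> cE dF; have cP := cylinder_nonsingular cE.
have [aE oE] := cE; have [sF aF] := dF.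
have rE z : nonsingular_preimage c c' Phi E z -> reg z /\ E (pj z).
  by rewrite nonsingular_preimageE.
apply: (@dfun_eq _ _ _ _ _ (fun z => (F \o @jext _ _ _ k) (jtrunc k (pj z)))) => //.
  move=> z /rE[_ Ez] /=; apply/esym/aF => //; exact/agree_sym/jext_trunc.
apply: (dfun_comp (U := @jext _ _ _ k @^-1` E)) => //; last first.
  move=> z /rE[_ Ez]; apply: aE Ez; exact/agree_sym/jext_trunc.
move=> j; apply: (@dfun_eq _ _ _ _ _ (fun z => pj z (jidxk_val (enum_val j)))) => //.
  by move=> z _; rewrite mxE.
have Jk : (jorder (jidxk_val (enum_val j)) < k.+1)%N by rewrite ltnS jidxk_val_order.
apply: (@dfun_sub _ _ _ _ reg); first by move=> z /rE[].
exact: (dfun_lift Jk (cylinder_regjet oW sL (ltn0Sn _)) (dfun_pjet oW sL _)).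
Qed.

(** Serves to replace [prolong], defined by choice, by the explicit [pjet] inside a derivative,
    where equality at one point would not do. *)
Lemma dform_eq k E (F F' : jet R p q -> R) z X : cylinder k E -> dfun k E F ->
  (forall z, E z -> F z = F' z) -> E z -> dform F z X = dform F' z X.
Proof.
move=> cE dF FF' Ez.
rewrite (dform_dfun X cE dF Ez) (dform_dfun X cE (dfun_eq cE FF' dF) Ez).
apply: (derive_eq_on _ cE.2) => [v Ev|]; first exact: FF'.
by apply: cE.1 Ez; exact/agree_sym/jext_trunc.
Qed.

Lemma coframe_hatE (Q : 'I_p -> 'I_p -> jet R p s -> R) i j z : reg z ->
  coframe_hat c c' Phi Q i j z = \sum_l Q i l (pj z) * tdmx L z j l.
Proof.
have oW := ldom_open; have sL := smooth_lrep.
move=> rz; rewrite /coframe_hat /hcoef /pullback /hform prolongE//.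
apply: eq_bigr => l _; congr (_ * _).
have cR := cylinder_regjet oW sL (ltn0Sn 0).
have /= dfl := dfun_pjet oW sL (inl l).
transitivity (dform (fun z => pj z (inl l)) z (total_vector j z)).
  apply/esym; apply: (dform_eq _ cR dfl _ rz) => z' rz'.
  by rewrite prolongE.
(* Along the independent coordinate [inl l] the component of D_i' is 1 for i' = l and 0
   otherwise. *)
rewrite (dform_pjet oW sL)// (bigD1 l)//= big1 ?eqxx ?mulr1 ?addr0// => i' i'l.
by rewrite eq_sym (negbTE i'l) mulr0.
Qed.

Lemma dform_linear r k E (F : jet R p r -> R) (z : jet R p r) (a : 'I_p -> R)
    (X : 'I_p -> jet R p r) : cylinder k E -> dfun k E F -> E z ->
  dform F z (fun A => \sum_l a l * X l A) = \sum_l a l * dform F z (X l).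
Proof.
move=> cE dF Ez; rewrite (dform_dfun _ cE dF Ez).
have Ev : E (jext (jtrunc k z)) by apply: cE.1 Ez; exact/agree_sym/jext_trunc.
have dFe := smooth_differentiable dF.1 Ev.
rewrite (deriveE _ dFe).
have -> : jtrunc k (fun A => \sum_l a l * X l A) = \sum_l a l *: jtrunc k (X l).
  by apply/rowP => j; rewrite mxE summxE; apply: eq_bigr => l _; rewrite !mxE.
rewrite linear_sum; apply: eq_bigr => l _.
by rewrite linearZ -(deriveE _ dFe) -(dform_dfun _ cE dF Ez).
Qed.

(** The prolongation maps the line defining [dform] to a curve, each coordinate of which is
    differentiable at 0; this is the situation of [derive_dfun]. *)
Lemma dform_comp_pjet k E F z X : cylinder k E -> dfun k E F -> reg z ->
  E (pj z) -> dform (F \o pj) z X =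
  dform F (pj z) (fun A => dform (fun z' => pj z' A) z X).
Proof.
have oW := ldom_open; have sL := smooth_lrep.
move=> cE dF rz Ez.
pose line (t : R) : jet R p q := fun A => z A + t * X A.
have line0 : line 0 = z by apply/funext => A; rewrite /line mul0r addr0.
have dline A : differentiable (fun t => line t A) (0 : R).
  apply: differentiableD; first exact: differentiable_cst.
  by apply: differentiableM; [exact: ex_diff|exact: differentiable_cst].
have dpj A : differentiable (fun t => pj (line t) A) (0 : R).
  have cR := cylinder_regjet oW sL (ltn0Sn (jorder A)).
  have r0 : reg (line 0) by rewrite line0.
  exact: (derive_dfun (F := fun z => pj z A) (gam := line) (1 : R) cR
    (dfun_pjet oW sL A) r0 dline).1.
have E0 : E (pj (line 0)) by rewrite line0.
have XE : (fun A => dform (fun z' => pj z' A) z X) =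
    (fun A => 'D_1 (fun t => pj (line t) A : R) (0 : R)).
  by apply/funext => A; exact: derive1E.
transitivity (dform F (pj (line 0))
    (fun A => 'D_1 (fun t => pj (line t) A : R) (0 : R))).
  apply: etrans (derive_dfun (gam := fun t => pj (line t)) (1 : R) cE dF E0 dpj).2.
  exact: derive1E.
by rewrite XE line0.
Qed.

Lemma hcoef_pullback k E F i z : cylinder k E -> dfun k E F -> reg z ->
  E (pj z) -> hcoef (dform (F \o prolong c c' Phi)) i z =
  \sum_l tdmx L z i l * hcoef (dform F) l (pj z).
Proof.
have oW := ldom_open; have sL := smooth_lrep.
move=> cE dF rz Ez; have rE : nonsingular_preimage c c' Phi E z.
  by rewrite nonsingular_preimageE.
rewrite /hcoef.
transitivity (dform (F \o pj) z (total_vector i z)).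
  apply/esym; apply: (dform_eq _ (cylinder_nonsingular cE) (dfun_pullback cE dF) _ rE).
  by move=> z'; rewrite nonsingular_preimageE => -[rz' _] /=; rewrite prolongE.
rewrite (dform_comp_pjet _ cE dF rz Ez).
rewrite -(dform_linear _ _ cE dF Ez); congr dform; apply/funext => A.
exact: (dform_pjet oW sL A i rz).
Qed.

End Map.
End Charts.

(** * Functoriality and the theorem *)

Section Functoriality.
Variable R : realType.
Local Notation ee i := (delta_mx (0 : 'I_1) i).

(** In a chart around [g] the section is the composite of the smooth map on the product with the
    affine embedding v |-> (coordinates of g, v). *)
Lemma smooth_map_section (a b d : nat) (A : manifold R a) (B : manifold R b)
    (C : manifold R d) (f : A -> B -> C) (g : A) :
  smooth_map2 f -> smooth_map (f g).
Proof.
move=> [cf sf]; have cfg : continuous (f g).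
  move=> x; have cp : {for x, continuous (fun x : B => (g, x) : A * B)}.
    by apply: cvg_pair; [exact: cvg_cst|exact: cvg_id].
  exact: (continuous_comp cp (cf (g, x))).
split=> // cB cC hB hC.
have [cA aA gA] := atlas_cover g.
have hA : coordinates cA by move=> c'; exact: atlas_compat.
have S2 := sf cA cB cC hA hB hC; set S := [set w | _] in S2.
have oS : open S.
  rewrite openE => w [iA iB dC].
  have n1 := near_preimage (@continuous_lsubmx _ 1 a b w) (@cimg_open _ _ _ cA) iA.
  have n2 := near_preimage (@continuous_rsubmx _ 1 a b w) (@cimg_open _ _ _ cB) iB.
  have c1 : {for w, continuous (fun w : 'rV[R]_(a + b) => cinv cA (lsubmx w))}.
    exact: (continuous_comp (@continuous_lsubmx _ 1 a b w) (cinv_cont iA)).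
  have c2 : {for w, continuous (fun w : 'rV[R]_(a + b) => cinv cB (rsubmx w))}.
    exact: (continuous_comp (@continuous_rsubmx _ 1 a b w) (cinv_cont iB)).
  have c3 : {for w, continuous (fun w : 'rV[R]_(a + b) =>
      f (cinv cA (lsubmx w)) (cinv cB (rsubmx w)))}.
    have cp : {for w, continuous (fun w : 'rV[R]_(a + b) =>
        (cinv cA (lsubmx w), cinv cB (rsubmx w)) : A * B)}.
      exact: (cvg_pair c1 c2).
    exact: (continuous_comp cp (cf _)).
  have n3 := near_preimage c3 (cdom_open cC) dC.
  by apply: filterS2 (filterI n1 n2) n3 => v [].
rewrite -ldomE => k.
have oU : open (ldom cB cC (f g)) by exact: open_ldom.
pose iota (v : 'rV[R]_b) : 'rV[R]_(a + b) := row_mx (cmap cA g) v.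
have ci : Ck k (ldom cB cC (f g)) iota.
  apply/Ck_row => // j; have [i ->|i ->] := split_ordP j.
    by apply: Ck_eq (Ck_cst k _ (cmap cA g 0 i)) => // v _; rewrite row_mxEl.
  by apply: Ck_eq (Ck_coord k _ i) => // v _; rewrite row_mxEr.
have iS v : ldom cB cC (f g) v -> S (iota v).
  move=> [iv dv]; rewrite /S /= /iota row_mxKl row_mxKr cmapK//.
  by split=> //; exists g.
apply: Ck_eq (Ck_comp oU oS iS ci (S2 k)) => // v _ /=.
by rewrite /lrep /iota /= row_mxKl row_mxKr cmapK.
Qed.

Lemma hform_total (p q : nat) (Q : 'I_p -> jet R p q -> R) i z z' :
  hform Q z (total_vector i z') = Q i z.
Proof.
rewrite /hform (bigD1 i)//= eqxx mulr1 big1 ?addr0// => j ji.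
by rewrite (negbTE ji) mulr0.
Qed.

(** On a prolonged graph the tangent vector tested by [contact_on] is D_i, so the value of each
    one-form is its dx^i-coefficient. *)
Lemma contact_defect (p q : nat) (M : manifold R (p + q))
    (c : chart R (p + q) M) (Phi : M -> M) (Q : 'I_p -> 'I_p -> jet R p q -> R)
    (f : 'rV[R]_p -> 'rV[R]_q) x i j :
  coordinates c -> smooth_map Phi -> smooth_near x f ->
  regjet (lrep c c Phi) (ldom c c Phi) (jet_graph f x) ->
  let X := fun A => 'D_(ee i) (fun y => jet_graph f y A : R) x in
  pullback (prolong c c Phi) (hform (Q j)) (jet_graph f x) X -
    hform (Q j) (jet_graph f x) X =
  \sum_l Q j l (pjet (lrep c c Phi) (jet_graph f x)) *
    tdmx (lrep c c Phi) (jet_graph f x) i l - Q j i (jet_graph f x).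
Proof.
move=> hc sPhi [U [oU Ux sf]] rz X.
have -> : X = total_vector i (jet_graph f x).
  by apply/funext => A; exact: derive_jet_graph oU sf Ux.
by rewrite hform_total -(coframe_hatE hc hc sPhi).
Qed.

Section Square.
Variables (p q s : nat) (M : manifold R (p + q)) (N : manifold R (p + s)).
Variables (cM : chart R (p + q) M) (cN : chart R (p + s) N).
Hypotheses (hM : coordinates cM) (hN : coordinates cN).
Variables (Pi : M -> N) (phi : M -> M) (psi : N -> N).
Hypotheses (sPi : smooth_map Pi) (sphi : smooth_map phi) (spsi : smooth_map psi).
Hypothesis square : forall a, Pi (phi a) = psi (Pi a).

Local Notation LPi := (lrep cM cN Pi).
Local Notation WPi := (ldom cM cN Pi).
Local Notation Lphi := (lrep cM cM phi).
Local Notation Wphi := (ldom cM cM phi).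
Local Notation Lpsi := (lrep cN cN psi).
Local Notation Wpsi := (ldom cN cN psi).

Lemma lrep_square v : WPi v -> Wphi v -> Lpsi (LPi v) = LPi (Lphi v).
Proof.
by move=> [_ dPi] [_ dphi]; rewrite /lrep /= !cmapK// square.
Qed.

Lemma prolongation_square f x : smooth_near x f ->
  regjet LPi WPi (jet_graph f x) -> regjet Lphi Wphi (jet_graph f x) ->
  regjet LPi WPi (pjet Lphi (jet_graph f x)) ->
  exists h y, [/\ smooth_near y h, jet_graph h y = pjet LPi (jet_graph f x),
    regjet Lpsi Wpsi (jet_graph h y),
    pjet Lpsi (jet_graph h y) = pjet LPi (pjet Lphi (jet_graph f x)) &
    tdmx Lphi (jet_graph f x) *m tdmx LPi (pjet Lphi (jet_graph f x)) =
    tdmx LPi (jet_graph f x) *m tdmx Lpsi (jet_graph h y)].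
Proof.
move=> [U [oU Ux sf]] rPi rphi rPiw.
have oWPi : open WPi by apply: open_ldom; exact: sPi.1.
have sLPi : smooth_on WPi LPi := smooth_lrep hM hN sPi.
have oWphi : open Wphi by apply: open_ldom; exact: sphi.1.
have sLphi : smooth_on Wphi Lphi := smooth_lrep hM hM sphi.
have oWpsi : open Wpsi by apply: open_ldom; exact: spsi.1.
have sLpsi : smooth_on Wpsi Lpsi := smooth_lrep hN hN spsi.
have [V1 [V1' [f' [g1 [IG1 V1x _ _ _]]]]] :=
  image_graph_exists oWphi sLphi oU Ux sf rphi.
have [V2 [V2' [h [g2 [IG2 V2x _ gY [sg gV Yg]]]]]] :=
  image_graph_exists oWPi sLPi oU Ux sf rPi.
pose Yphi x := lsubmx (graph_image Lphi f x).
pose YPi x := lsubmx (graph_image LPi f x).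
have wE : jet_graph f' (Yphi x) = pjet Lphi (jet_graph f x).
  exact: (pjet_graph oWphi sLphi IG1 V1x).
have zE : jet_graph h (YPi x) = pjet LPi (jet_graph f x).
  exact: (pjet_graph oWPi sLPi IG2 V2x).
rewrite -wE in rPiw *.
have [V3 [V3' [h' [g3 [IG3 V3x _ _ _]]]]] :=
  image_graph_exists oWPi sLPi (ig_open' IG1) (ig_dom IG1 V1x) (ig_smooth' IG1) rPiw.
exists h, (YPi x).
have dYphi := differentiable_image oWphi sLphi IG1 V1x.
have dYPi := differentiable_image oWPi sLPi IG2 V2x.
pose A := [set y | [/\ V1 y, V2 y & V3 (Yphi y)]].
have nA : nbhs x A.
  have n1 : \forall y \near x, V1 y.
    by apply: open_nbhs_nbhs; split=> //; exact: ig_open IG1.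
  have n2 : \forall y \near x, V2 y.
    by apply: open_nbhs_nbhs; split=> //; exact: ig_open IG2.
  have n3 := near_preimage (differentiable_continuous dYphi) (ig_open IG3) V3x.
  by apply: filterS2 (filterI n1 n2) n3 => y [].
have imE y : A y -> graph_image Lpsi h (YPi y) = graph_image LPi f' (Yphi y).
  move=> [V1y V2y _]; rewrite /graph_image (ig_eq IG1 V1y) (ig_eq IG2 V2y).
  rewrite !hsubmxK; apply: lrep_square; [exact: ig_base IG2 _ V2y|exact: ig_base IG1 _ V1y].
have WpsiE y : A y -> Wpsi (row_mx (YPi y) (h (YPi y))).
  move=> [V1y V2y V3y]; rewrite (ig_eq IG2 V2y) hsubmxK.
  have [iPi dPi] := ig_base IG2 V2y; have [_ dphi] := ig_base IG1 V1y.
  have [_ dPi'] := ig_base IG3 V3y.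
  split; first by exists (Pi (cinv cM (row_mx y (f y)))).
  rewrite /graph_image /lrep /= cmapK// -square.
  by move: dPi'; rewrite (ig_eq IG1 V1y) hsubmxK /graph_image /lrep /= cmapK.
(* [A] collects the points where all three graph descriptions apply, the only ones where
   commutativity can be read in the charts. *)
have Ax : A x by split.
pose U2 := V2' `&` [set y | Wpsi (jbase (jet_graph h y))].
have oU2 : open U2 := open_jet_graph (ig_open' IG2) (ig_smooth' IG2) (cylinder_base oWpsi 0).
have sh : smooth_on U2 h by move=> n; apply: Ck_sub (ig_smooth' IG2 n) => y [].
have U2x : U2 (YPi x).
  by split; [exact: ig_dom IG2 _ V2x|rewrite /= jbase_graph; exact: WpsiE].
have UW y : U2 y -> Wpsi (row_mx y (h y)) by move=> [_ /=]; rewrite jbase_graph.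
have T : tdmx Lphi (jet_graph f x) *m tdmx LPi (jet_graph f' (Yphi x)) =
    tdmx LPi (jet_graph f x) *m tdmx Lpsi (jet_graph h (YPi x)).
  have dYpsi := smooth_differentiable (smooth_lsub_image oWpsi sLpsi oU2 sh UW) U2x.
  have dYPi' := differentiable_image oWPi sLPi IG3 V3x.
  apply/row_matrixP => i; rewrite !rowE.
  rewrite -(jac_lsub_image oWphi sLphi (ig_open IG1) (ig_smooth IG1) (ig_base IG1) V1x).
  rewrite -(jac_lsub_image oWPi sLPi (ig_open IG2) (ig_smooth IG2) (ig_base IG2) V2x).
  rewrite -(jac_lsub_image oWPi sLPi (ig_open IG3) (ig_smooth IG3) (ig_base IG3) V3x).
  rewrite -(jac_lsub_image oWpsi sLpsi oU2 sh UW U2x).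
  rewrite !mulmxA -(derive_jac _ dYphi) -(derive_jac _ dYPi).
  rewrite -(derive_jac _ dYPi') -(derive_jac _ dYpsi).
  rewrite -(derive_chain _ dYphi dYPi') -(derive_chain _ dYPi dYpsi).
  apply: near_eq_derive; apply: filterS nA => y Ay /=.
  by rewrite -/(YPi y) imE.
(* Taking determinants in [T]: the two factors on the left are nonzero, hence so are those on the
   right. *)
have rz1 : regjet Lpsi Wpsi (jet_graph h (YPi x)).
  split; first by rewrite jbase_graph; exact: WpsiE.
  have [_ d1] := rphi; have [_ d2] := rPiw.
  have : \det (tdmx LPi (jet_graph f x) *m tdmx Lpsi (jet_graph h (YPi x))) != 0.
    rewrite -T det_mulmx; exact: mulf_neq0 d1 d2.
  by rewrite det_mulmx mulf_eq0 negb_or => /andP[].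
split=> //.
  exists V2'; split; [exact: ig_open' IG2|exact: ig_dom IG2 _ V2x|].
  exact: ig_smooth' IG2.
have V3'x : V3' (lsubmx (graph_image Lpsi h (YPi x))).
  by rewrite imE//; exact: ig_dom IG3 _ V3x.
(* [imE] speaks of points of the form [YPi y]; a point near [YPi x] is brought to this form by the
   local inverse [g2]. *)
have hE : \forall y \near YPi x, h' (lsubmx (graph_image Lpsi h y)) =
    rsubmx (graph_image Lpsi h y).
  have V2'x : V2' (YPi x) := ig_dom IG2 V2x.
  have cg := smooth_continuous sg V2'x.
  have n1 := near_continuous cg (gY _ V2x) nA.
  have n2 := open_nbhs_nbhs (conj (ig_open' IG2) V2'x).
  apply: filterS2 n1 n2 => y Agy V2'y.
  have := imE _ Agy; rewrite /YPi (Yg _ V2'y) => ->.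
  by apply: (ig_eq IG3); case: Agy.
have [V IG Vx] := image_graph_near hN hN spsi (ig_open' IG2) (ig_dom IG2 V2x)
  (ig_smooth' IG2) (ig_open' IG3) (ig_smooth' IG3) rz1 V3'x hE.
rewrite -(pjet_graph oWpsi sLpsi IG Vx) imE//.
exact: (pjet_graph oWPi sLPi IG3 V3x).
Qed.

End Square.
End Functoriality.

Theorem theorem7 (R : realType) (d p q s : nat)
  (hp : (1 <= p)%N) (hpn : (p < p + s)%N) (hnm : (p + s < p + q)%N)
  (M : manifold R (p + q)) (N : manifold R (p + s))
  (Pi : M -> N)
  (Pi_smooth : smooth_map Pi)
  (Pi_surj : forall v, exists z, Pi z = v)
  (Pi_rank : constant_rank Pi)
  (G : lieGroup R d) (act : G -> M -> M)
  (hact : smooth_action act) (hproj : projectable act Pi)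
  (cM : chart R (p + q) M) (hcM : coordinates cM)
  (cN : chart R (p + s) N) (hcN : coordinates cN)
  (D : set (jet R p s)) (om : 'I_p -> 'I_p -> jet R p s -> R)
  (om_coframe : horizontal_coframe cN D om)
  (om_inv : contact_invariant cN [set induced_action act Pi g | g in [set: G]] D om)
  (DD : 'I_p -> (jet R p s -> R) -> (jet R p s -> R))
  (hDD : dual_operators cN D om DD) :
  let Dhat := nonsingular_preimage cM cN Pi D in
  let omhat := coframe_hat cM cN Pi om in
  [/\ horizontal_coframe cM Dhat omhat,
      contact_invariant cM [set act g | g in [set: G]] Dhat omhat &
      forall DDhat : 'I_p -> (jet R p q -> R) -> (jet R p q -> R),
        dual_operators cM Dhat omhat DDhat ->
        forall (k : nat) (E : set (jet R p s)) (F : jet R p s -> R),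
          differential_function_of_order cN k E F ->
          let Fhat := F \o prolong cM cN Pi in
          differential_function cM (nonsingular_preimage cM cN Pi E) Fhat /\
          forall (i : 'I_p) (z : jet R p q),
            Dhat z -> E (prolong cM cN Pi z) ->
            DDhat i Fhat z = DD i F (prolong cM cN Pi z)].
Proof.
move=> Dhat omhat.
have oW : open (ldom cM cN Pi) by apply: open_ldom; exact: Pi_smooth.1.
have sL : smooth_on (ldom cM cN Pi) (lrep cM cN Pi) := smooth_lrep hcM hcN Pi_smooth.
pose L := lrep cM cN Pi.
have [om_fun om_free] := om_coframe.
have DhatE z : Dhat z -> regjet L (ldom cM cN Pi) z /\ D (pjet L z).
  by rewrite /Dhat (nonsingular_preimageE hcM hcN Pi_smooth).
have jets_hat E : nonsingular_preimage cM cN Pi E `<=` jets_over cM by move=> z [].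
have omhatE i j z : Dhat z ->
    omhat i j z = \sum_l om i l (pjet L z) * tdmx L z j l.
  by move=> /DhatE[rz _]; rewrite /omhat (coframe_hatE hcM hcN Pi_smooth).
have omhat_free z : Dhat z -> row_free (\matrix_(i, j) omhat i j z).
  move=> Dz; have [[_ dz] Dw] := DhatE _ Dz.
  have -> : \matrix_(i, j) omhat i j z =
      (\matrix_(i, j) om i j (pjet L z)) *m (tdmx L z)^T.
    apply/matrixP => i j; rewrite !mxE omhatE//; apply: eq_bigr => l _.
    by congr (_ * _); rewrite [RHS]mxE.
  have := om_free _ Dw; rewrite !row_free_unit unitmx_mul => ->.
  by rewrite unitmx_tr unitmxE unitfE.
split.
- split=> // i j.
  (* The coefficients may have different orders and are lifted to the largest. That [D] is a
     cylinder is read off one coefficient, which exists because p >= 1. *)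
  have [K HK] := fin_all_exists (fun l => om_fun i l).
  have HK' l := (dfunP _ _ _ _).1 (HK l).
  pose k := (\max_l K l)%N.
  have cD : cylinder k D.
    have [_ c0 _] := HK' (Ordinal hp).
    by apply: cylinder_lift c0; exact: leq_bigmax.
  have dom l : dfun k D (om i l).
    have [_ cl dl] := HK' l.
    by apply: (dfun_lift _ cl dl); exact: leq_bigmax.
  have cDh := cylinder_nonsingular hcM hcN Pi_smooth cD.
  exists k.+1; apply/dfunP; split; [exact: jets_hat|exact: cDh|].
  apply: (@dfun_eq _ _ _ _ _ (fun z => \sum_l om i l (pjet L z) * tdmx L z j l)) => //.
    by move=> z Dz; rewrite omhatE.
  apply: dfun_sum => [//|l]; apply: dfunM; first exact: cDh.
    exact: (dfun_pullback hcM hcN Pi_smooth cD (dom l)).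
  apply: (@dfun_sub _ _ _ _ [set z | ldom cM cN Pi (jbase z)]).
    by move=> z /DhatE[[]].
  exact: (dfun_lift (ltn0Sn k) (cylinder_base oW 1) (dfun_tdmx oW sL j l)).
- move=> phi [g _ <-]; have sphi : smooth_map (act g).
    exact: smooth_map_section (act_smooth hact).
  split=> // j f x sf [Dz [w pw Dw]] i.
  pose psi := induced_action act Pi g.
  (* [act g] carries the fibre through [a] onto the fibre over [psi (Pi a)], and [act g a] lies in
     it; projectability excludes the default case of [xget]. *)
  have square a : Pi (act g a) = psi (Pi a).
    rewrite /psi /induced_action; case: xgetP => [v' _ /= E|H].
      have : (act g @` (Pi @^-1` [set Pi a])) (act g a) by exists a.
      by rewrite E.
    by have [v' Hv'] := hproj (Pi a) g; case: (H v').
  have [spsi inv] := om_inv psi (ex_intro2 _ _ g I erefl).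
  have [rphi wE] := prolongs_unique hcM hcM sphi pw.
  have [rPi Dz'] := DhatE _ Dz; have [rPiw Dw'] := DhatE _ Dw.
  rewrite wE in rPiw Dw Dw'.
  have [h [y [sh hE rpsi pE TE]]] :=
    prolongation_square hcM hcN Pi_smooth sphi spsi square sf rPi rphi rPiw.
  rewrite (contact_defect _ _ _ hcM sphi sf rphi) omhatE//.
  have Dh : D (jet_graph h y) by rewrite hE.
  (* The invariance of the given coframe is tested on the graph of [h], which represents the
     prolonged image of the jet. *)
  have inv_k k : \sum_l om j l (pjet (lrep cN cN psi) (jet_graph h y)) *
      tdmx (lrep cN cN psi) (jet_graph h y) k l = om j k (jet_graph h y).
    apply/eqP; rewrite -subr_eq0 -(contact_defect om k j hcN spsi sh rpsi); apply/eqP.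
    apply: inv => //; split=> //.
    exists (pjet (lrep cN cN psi) (jet_graph h y)).
      exact: (prolongs_exists hcN hcN spsi rpsi).
    by rewrite pE.
  set z := jet_graph f x in Dz rPi rphi rPiw Dz' Dw' Dw hE pE TE wE *.
  (* [r] holds the coefficients of the [j]-th form at the image of the transformed jet. By [TE], D_0
     g (D_0 Pi r) = D_0 Pi (D_0 [g] r), and by [inv_k] the column D_0 [g] r holds the coefficients
     at the image of [z]. *)
  pose r : 'cV[R]_p := \col_l om j l (pjet L (pjet (lrep cM cM (act g)) z)).
  apply/eqP; rewrite subr_eq0; apply/eqP.
  transitivity ((tdmx (lrep cM cM (act g)) z *m
      (tdmx L (pjet (lrep cM cM (act g)) z) *m r)) i 0).
    rewrite [RHS]mxE; apply: eq_bigr => l _; rewrite mulrC; congr (_ * _).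
    rewrite omhatE// [RHS]mxE; apply: eq_bigr => m _.
    by rewrite mulrC; congr (_ * _); rewrite [RHS]mxE.
  rewrite mulmxA TE -mulmxA [LHS]mxE; apply: eq_bigr => k _; rewrite mulrC.
  congr (_ * _); rewrite -hE -inv_k [LHS]mxE pE; apply: eq_bigr => l _.
  by rewrite mulrC; congr (_ * _); rewrite [LHS]mxE.
move=> DDhat hDDhat k E F /[dup] HF /dfunP[_ cE dF] Fhat.
have HFhat : differential_function cM (nonsingular_preimage cM cN Pi E) Fhat.
  exists k.+1; apply/dfunP; split; first exact: jets_hat.
    exact: (cylinder_nonsingular hcM hcN Pi_smooth cE).
  apply: dfun_eq (dfun_pullback hcM hcN Pi_smooth cE dF).
    exact: (cylinder_nonsingular hcM hcN Pi_smooth cE).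
  move=> z; rewrite (nonsingular_preimageE hcM hcN Pi_smooth) => -[rz _] /=.
  by rewrite /Fhat /= (prolongE hcM hcN Pi_smooth).
split=> // i z Dz; have [rz Dw] := DhatE _ Dz.
rewrite (prolongE hcM hcN Pi_smooth rz) => Ew.
have Ez : nonsingular_preimage cM cN Pi E z.
  by rewrite (nonsingular_preimageE hcM hcN Pi_smooth).
have hF l : hcoef (dform F) l (pjet L z) =
    \sum_j DD j F (pjet L z) * om j l (pjet L z).
  have := hDD _ _ (ex_intro _ k HF) _ Dw Ew (total_vector l (pjet L z)).
  rewrite /dH /piH hform_total => ->.
  by apply: eq_bigr => j _; rewrite hform_total.
have hFhat l : hcoef (dform Fhat) l z = \sum_j DDhat j Fhat z * omhat j l z.
  have := hDDhat _ _ HFhat _ Dz Ez (total_vector l z).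
  rewrite /dH /piH hform_total => ->.
  by apply: eq_bigr => j _; rewrite hform_total.
pose a : 'rV[R]_p := \row_j DDhat j Fhat z.
pose b : 'rV[R]_p := \row_j DD j F (pjet L z).
(* The lifted forms are independent, so it suffices that [a] and [b] become equal after
   multiplication by their coefficient matrix; both products have the entries D_l of [Fhat]. *)
suff /rowP/(_ i) : a = b by rewrite !mxE.
apply: (row_free_inj (omhat_free _ Dz)); apply/rowP => l.
transitivity (hcoef (dform Fhat) l z).
  by rewrite hFhat mxE; apply: eq_bigr => j _; rewrite !mxE.
rewrite (hcoef_pullback hcM hcN Pi_smooth l cE dF rz Ew) mxE.
under eq_bigr do rewrite hF mulr_sumr.
rewrite exchange_big /=; apply: eq_bigr => j _; rewrite !mxE omhatE// mulr_sumr.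
by apply: eq_bigr => m _; rewrite mulrCA [X in _ * X = _]mulrC.
Qed.
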